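(* Let $\mathcal{P}$ be a finite classical polar space of rank $d>2$, order $q$ and type $\epsilon$, and let $t$ be an even integer with $d\ge 2t\ge 0$. Define $$b_1^0=\genfrac{[}{]}{0pt}{}{d-\frac32 t}{\frac t2-1}_q\, c_{2t-1,t},\qquad b_2^0=q^{\epsilon\frac t2+\binom{t/2}{2}}\,\psi^0,$$ where $$\psi^0=q^{\frac34 t^2}\sum_{i=1}^{t/2-1} q^{(\frac t2-1-i)(\frac t2-i)}\genfrac{[}{]}{0pt}{}{d-2t+1}{\frac t2-i}_q\genfrac{[}{]}{0pt}{}{\frac t2-1}{i}_q .$$ Let $Y$ be a maximal $(d,t)$-EKR set of generators of $\mathcal{P}$ with $|Y|>b_1^0+b_2^0$. Then there is a generator $G$ such that $Y$ is the set of all generators meeting $G$ in a subspace of dimension at least $d-\frac t2$.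
   Context: Finite classical polar spaces: $Q^+(2d-1,q)$, $H(2d-1,q)$, $Q(2d,q)$, $W(2d-1,q)$, $H(2d,q)$, $Q^-(2d+1,q)$ with type $\epsilon=0,\frac12,1,1,\frac32,2$ respectively; the elements are totally isotropic (totally singular) subspaces; generators are the maximal ones, of (vector space) dimension $d$ = rank. A $(d,t)$-EKR set is a set $Y$ of generators with $d-\dim(y_1\cap y_2)\le t$ for all $y_1,y_2\in Y$; it is maximal if it is not properly contained in another $(d,t)$-EKR set. $c_{n,t}$ denotes the maximum size of an $(n,t)$-EKR set of generators in a polar space of rank $n$ (of the same type and order). The Gaussian coefficient $\genfrac{[}{]}{0pt}{}{n}{k}_q=\prod_{i=1}^k\frac{q^{n-i+1}-1}{q^i-1}$ if $0\le k\le n$ and $0$ otherwise; $\binom{m}{2}=m(m-1)/2$. *)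

(* Defs.v *)
From HB Require Import structures.
From mathcomp Require Import all_boot all_order all_algebra.

Set Implicit Arguments.
Unset Strict Implicit.
Unset Printing Implicit Defensive.

Import Order.TTheory GRing.Theory Num.Theory.
Local Open Scope ring_scope.

Section FiniteVspace.
Import VectorInternalTheory.
Variables (F : finFieldType) (V : vectType F).
HB.instance Definition _ := [Countable of {vspace V} by <:].
HB.instance Definition _ := [Finite of {vspace V} by <:].
End FiniteVspace.

(* For rank d the families are Q^+(2d-1,q), H(2d-1,q), Q(2d,q), W(2d-1,q),    *)
(* H(2d,q) and Q^-(2d+1,q); the Hermitian ones live over the field of order   *)
(* q, with q a square.                                                        *)
Inductive polar_family :=
  | Hyperbolic | HermitianOdd | Parabolic | Symplectic | HermitianEven
  | Elliptic.

Inductive form_kind := QuadraticForm | AlternatingForm | HermitianForm.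

Definition kind_of (T : polar_family) : form_kind :=
  match T with
  | Hyperbolic | Parabolic | Elliptic => QuadraticForm
  | Symplectic => AlternatingForm
  | HermitianOdd | HermitianEven => HermitianForm
  end.

(* Twice the type epsilon, so that it is a natural number. *)
Definition two_eps (T : polar_family) : nat :=
  match T with
  | Hyperbolic => 0
  | HermitianOdd => 1
  | Parabolic => 2
  | Symplectic => 2
  | HermitianEven => 3
  | Elliptic => 4
  end.

(* Vector space dimension: one more than the projective dimension. *)
Definition ambient_dim (T : polar_family) (d : nat) : nat :=
  match T with
  | Hyperbolic | HermitianOdd | Symplectic => (2 * d)%N
  | Parabolic | HermitianEven => (2 * d).+1%N
  | Elliptic => (2 * d).+2%N
  end.

Section Forms.
Variables (F : finFieldType) (m : nat).
Local Notation V := 'rV[F]_m.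
Implicit Types (A : 'M[F]_m) (u v : V) (U W : {vspace V}).

(* The involution x |-> x^(sqrt q) of F, when #|F| = q is a square. *)
Definition conjF (x : F) : F := x ^+ Nat.sqrt #|F|.

(* Every quadratic form on F^m is v |-> v A v^T for some (non-unique) A. *)
Definition qform A v : F := form_of_matrix idfun A v v.

Definition polar_form A u v : F := qform A (u + v) - qform A u - qform A v.

(* The condition in the quadratic case is that no nonzero singular vector lies *)
(* in the radical of the polar form; this is the right notion of nondegeneracy *)
(* in characteristic 2 too, where the polar form of a parabolic quadric has a  *)
(* one-dimensional radical.                                                    *)
Definition nondegenerate_form (K : form_kind) A : bool :=
  match K with
  | QuadraticForm =>
      [forall v : V, (qform A v == 0) && [forall u : V, polar_form A u v == 0]
                   ==> (v == 0)]
  | AlternatingForm =>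
      [forall v : V, form_of_matrix idfun A v v == 0]
      && [forall v : V, [forall u : V, form_of_matrix idfun A u v == 0] ==> (v == 0)]
  | HermitianForm =>
      [&& #|F| == (Nat.sqrt #|F| ^ 2)%N,
          A \is hermitianmx m false conjF
        & [forall v : V, [forall u : V, form_of_matrix conjF A u v == 0] ==> (v == 0)]]
  end.

Definition totally_singular (K : form_kind) A U : bool :=
  match K with
  | QuadraticForm => [forall v : V in U, qform A v == 0]
  | AlternatingForm =>
      [forall u : V in U, forall v : V in U, form_of_matrix idfun A u v == 0]
  | HermitianForm =>
      [forall u : V in U, forall v : V in U, form_of_matrix conjF A u v == 0]
  end.

Definition polar_rank (K : form_kind) A : nat :=
  \max_(U : {vspace V} | totally_singular K A U) \dim U.

Definition generator (K : form_kind) A U : bool :=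
  totally_singular K A U
  && [forall W : {vspace V},
        totally_singular K A W && (U <= W)%VS ==> (W == U)].

End Forms.

Section PolarSpaces.
Variables (F : finFieldType) (T : polar_family) (d : nat).
Implicit Types (A : 'M[F]_(ambient_dim T d)).

(* The matrix A defines a polar space of family T, rank d and order #|F|. *)
Definition is_polar_space A : bool :=
  nondegenerate_form (kind_of T) A && (polar_rank (kind_of T) A == d).

Definition is_generator A (U : {vspace 'rV[F]_(ambient_dim T d)}) : bool :=
  generator (kind_of T) A U.

Definition is_EKR A (t : nat) (Y : {set {vspace 'rV[F]_(ambient_dim T d)}}) :
    bool :=
  [forall y in Y, is_generator A y]
  && [forall y1 in Y, forall y2 in Y, (d - \dim (y1 :&: y2) <= t)%N].

Definition is_maximal_EKR A (t : nat)
    (Y : {set {vspace 'rV[F]_(ambient_dim T d)}}) : bool :=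
  maxset (is_EKR A t) Y.

End PolarSpaces.

(* The maximum runs over all polar spaces of the given family, rank and order  *)
(* (they are isomorphic). For n = 2t - 1 and t = 0 it is a junk value.         *)
Definition EKR_max (F : finFieldType) (T : polar_family) (n t : nat) : nat :=
  \max_(A : 'M[F]_(ambient_dim T n) | is_polar_space A)
    \max_(Y : {set {vspace 'rV[F]_(ambient_dim T n)}} | is_EKR A t Y) #|Y|.

Section Bounds.
Variable R : rcfType.

(* Integer arguments, so that the coefficient is 0 for k = -1. *)
Definition gauss (q : R) (n k : int) : R :=
  if (0 <= k <= n) then
    \prod_(1 <= i < `|k|%N.+1) ((q ^ (n - i%:Z + 1) - 1) / (q ^+ i - 1))
  else 0.

Variables (F : finFieldType) (T : polar_family) (d t : nat).

Definition b10 : R :=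
  let q : R := #|F|%:R in
  let s := t./2 in
  gauss q (d%:Z - 3 * s%:Z) (s%:Z - 1) * (EKR_max F T (2 * t - 1)%N t)%:R.

Definition psi0 : R :=
  let q : R := #|F|%:R in
  let s := t./2 in
  q ^+ (3 * s ^ 2)%N
  * \sum_(1 <= i < s)
      q ^+ ((s - 1 - i) * (s - i))%N
      * gauss q (d%:Z - 2 * t%:Z + 1) (s%:Z - i%:Z)
      * gauss q (s%:Z - 1) i%:Z.

(* epsilon may be a half-integer: q^(epsilon t/2) is written as               *)
(* (sqrt q)^((2 epsilon) (t/2)).                                              *)
Definition b20 : R :=
  let q : R := #|F|%:R in
  let s := t./2 in
  Num.sqrt q ^+ (two_eps T * s)%N * q ^+ 'C(s, 2) * psi0.

End Bounds.

(* Main.v *)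
Require Import Defs.
From HB Require Import structures.
From mathcomp Require Import all_boot all_order all_algebra all_field.
From mathcomp Require Import zify ring.

Set Implicit Arguments.
Unset Strict Implicit.
Unset Printing Implicit Defensive.

Import Order.TTheory GRing.Theory Num.Theory.
Local Open Scope ring_scope.

(* Put s = t/2. For generators y1, y2, y3 the sum G of the three pairwise
   intersections is totally singular, so its dimension, which is the sum of the
   three dimensions minus twice that of S = y1 n y2 n y3, is at most d. Hence
   any three members of Y meet in dimension at least d - 3s. Take a triple for
   which dim S is minimal.
   - If dim S > d - 3s, the same count shows that every member of Y meets any
     (d - 3s)-subspace S' of S in dimension > d - 4s. Each such member contains
     one of the [d - 3s, s - 1] subspaces P of S' of dimension d - 4s + 1, and
     the members containing P form an EKR set in the quotient of the perp of P
     by P, so that |Y| <= b1.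
   - If dim S = d - 3s, then G is a generator, and every y in Y with
     dim(y n S) <= d - 4s meets G in dimension d - s. The other members of Y
     are bounded by b1 as before. If some y0 in Y meets G in dimension < d - s,
     pick L inside y0 n S of dimension d - 4s + 1; applying the dimension count
     to y, G, y0 shows that K = y n S meets L in codimension less than s. The
     sum in psi counts such K, q^(3 s^2) bounds the number of subspaces
     E = y n G of G with E n S = K, and q^(eps s + C(s,2)) the number of
     generators y with y n G = E. Thus |Y| <= b1 + b2. Otherwise Y lies in the
     set of generators meeting G in dimension >= d - s, which is an EKR set. *)

(** * Counting subspaces *)

Lemma card_fiber_le (S U : finType) (X : {set S}) (Z : {set U}) (f : S -> U)
    (N : nat) :
  {in X, forall x, f x \in Z} ->
  {in Z, forall z, (#|[set x in X | f x == z]| <= N)%N} ->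
  (#|X| <= #|Z| * N)%N.
Proof.
move=> fXZ fib; rewrite -sum1_card (partition_big f (mem Z)) //=.
rewrite -[leqRHS]sum_nat_const; apply: leq_sum => z zZ.
by rewrite sum1_card; have := fib z zZ; rewrite cardsE.
Qed.

Section Subspaces.
Variables (F : finFieldType) (V : vectType F).
Implicit Types (U W K L M N S : {vspace V}).
Local Notation q := #|F|.

Lemma dimv_add_line U v : v \notin U -> \dim (U + <[v]>)%VS = (\dim U).+1.
Proof.
move=> vU; have v0 : v != 0 by apply: contraNneq vU => ->; rewrite mem0v.
have := dimv_sum_cap U <[v]>; rewrite dim_vline v0 addn1 => <-.
suff -> : (U :&: <[v]> = 0)%VS by rewrite dimv0 addn0.
apply/eqP; rewrite -subv0; apply/subvP => x /memv_capP[xU /vlineP[k xk]].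
rewrite xk in xU *; rewrite memv0; have [->|k0] := eqVneq k 0.
  by rewrite scale0r.
by case/negP: vU; rewrite -[v]scale1r -(mulVf k0) -scalerA memvZ.
Qed.

Lemma subv_dim_between U W k : (U <= W)%VS -> (\dim U <= k <= \dim W)%N ->
  exists2 X : {vspace V}, (U <= X <= W)%VS & \dim X = k.
Proof.
move=> UW /andP[/subnKC <-]; move: (k - _)%N => {k} n.
elim: n => [|n IHn] nW; first by exists U; rewrite ?subvv ?addn0.
have [X /andP[UX XW] dX] := IHn ltac:(lia).
have /subvPn[v vW vX] : ~~ (W <= X)%VS.
  by apply/negP => /dimvS; rewrite dX; lia.
exists (X + <[v]>)%VS; last by rewrite dimv_add_line // dX addnS.
by rewrite (subv_trans UX (addvSl _ _)) subv_add XW -memvE.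
Qed.

(** The first two intersections lie in [y1], so their sum meets [y2 :&: y3] exactly in the triple
    intersection; the dimension formula for sums is then applied twice. *)
Lemma dimv_pairwise_cap (y1 y2 y3 : {vspace V}) :
  (\dim (y1 :&: y2 + y1 :&: y3 + y2 :&: y3)
   + 2 * \dim (y1 :&: y2 :&: y3)
   = \dim (y1 :&: y2) + \dim (y1 :&: y3) + \dim (y2 :&: y3))%N.
Proof.
have := dimv_sum_cap (y1 :&: y2) (y1 :&: y3).
have := dimv_sum_cap (y1 :&: y2 + y1 :&: y3) (y2 :&: y3).
have -> : (y1 :&: y2 :&: (y1 :&: y3) = y1 :&: y2 :&: y3)%VS.
  by apply/vspaceP => x; rewrite !memv_cap; do 3!case: (x \in _).
suff -> : ((y1 :&: y2 + y1 :&: y3) :&: (y2 :&: y3) = y1 :&: y2 :&: y3)%VS by lia.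
apply/eqP; rewrite eqEsubv !subv_cap -!andbA; do !(apply/andP; split).
- apply: subv_trans (capvSl _ _) _.
  by rewrite subv_add !capvSl.
- by rewrite (subv_trans (capvSr _ _)) ?capvSl.
- by rewrite (subv_trans (capvSr _ _)) ?capvSr.
- by rewrite (subv_trans _ (addvSl _ _)) ?capvSl.
- by rewrite (subv_trans (capvSl _ _)) ?capvSr.
- exact: capvSr.
Qed.

(** Relative to one member [K0], all members are graphs. With complements [X] of [M] in [K0] and [D]
    of [M] in [L], each is spanned by [M] and the vectors [x - l x] for a linear map [l] from [X] to
    [D], so a matrix determines it. *)
Lemma card_relative_complements M L N :
  (#|[set K : {vspace V} | (K :&: L == M)%VS && (K + L == N)%VS]|
   <= q ^ ((\dim N - \dim L) * (\dim L - \dim M)))%N.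
Proof.
set A := [set K | _]; have [->|[K0]] := set_0Vmem A; first by rewrite cards0.
rewrite inE => /andP[/eqP KLM0 /eqP KLN0].
have ML : (M <= L)%VS by rewrite -KLM0 capvSr.
have MK0 : (M <= K0)%VS by rewrite -KLM0 capvSl.
set D := (L :\: M)%VS; set X := (K0 :\: M)%VS.
have LMD : (D + M)%VS = L by rewrite addv_diff; apply/addv_idPl.
have KMX : (X + M)%VS = K0 by rewrite addv_diff; apply/addv_idPl.
have dD : \dim D = (\dim L - \dim M)%N.
  by have := dimv_cap_compl L M; rewrite (capv_idPr ML) -/D; lia.
have dX : \dim X = (\dim N - \dim L)%N.
  have := dimv_cap_compl K0 M; have := dimv_sum_cap K0 L.
  by rewrite KLM0 KLN0 (capv_idPr MK0) -/X; lia.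
pose l (a : 'M[F]_(\dim X, \dim D)) j := \sum_k a j k *: (vbasis D)`_k.
pose phi a := (M + <<[seq (vbasis X)`_j - l a j | j : 'I_(\dim X)]>>)%VS.
rewrite -dD -dX -card_mx -cardsT.
apply: leq_trans (subset_leq_card _) (leq_imset_card phi _).
apply/subsetP => K; rewrite inE => /andP[/eqP KLM /eqP KLN].
have MK : (M <= K)%VS by rewrite -KLM capvSl.
(* Since [N = K + D + M] and [M <= K], each basis vector of [X] is congruent modulo [K] to a vector
   of [D], whose coordinates form a row of the matrix. *)
have /fin_all_exists[f fP] : forall j : 'I_(\dim X),
    exists u : 'rV_(\dim D),
      (vbasis X)`_j - \sum_k u 0 k *: (vbasis D)`_k \in K.
  move=> j; have : (vbasis X)`_j \in N.
    rewrite -KLN0 (subvP (addvSl _ _)) // -KMX (subvP (addvSl _ _)) //.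
    by rewrite (basis_mem (vbasisP X)) // mem_nth ?size_tuple.
  rewrite -KLN -LMD => /memv_addP[k kK [_ /memv_addP[e eD [u uM ->]] ->]].
  exists (\row_i coord (vbasis D) i e).
  under eq_bigr do rewrite mxE.
  rewrite -(coord_vbasis eD) addrCA addrAC subrr add0r.
  by rewrite memvD // (subvP MK).
apply/imsetP; exists (\matrix_j f j) => //; set a := \matrix_j f j.
have lE j : l a j = \sum_k f j 0 k *: (vbasis D)`_k.
  by apply: eq_bigr => k _; rewrite mxE.
apply/eqP; rewrite eq_sym eqEdim; apply/andP; split.
  rewrite subv_add MK; apply/span_subvP => _ /mapP[j _ ->].
  by rewrite lE fP.
(* Equality follows by dimension: [phi a] meets [L] in at least [M] and spans with it at least [N],
   so it is no smaller than [K]. *)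
have Mphi : (M <= phi a :&: L)%VS by rewrite subv_cap addvSl ML.
have Nphi : (N <= phi a + L)%VS.
  rewrite -KLN0 subv_add addvSr andbT -KMX subv_add.
  apply/andP; split; last by rewrite (subv_trans ML) ?addvSr.
  rewrite -(span_basis (vbasisP X)); apply/span_subvP => _ /(nthP 0)[j jX <-].
  rewrite size_tuple in jX; rewrite -(subrK (l a (Ordinal jX)) _`_j).
  apply: memv_add.
    apply: subvP (addvSr _ _) _ _; apply: memv_span.
    by apply/mapP; exists (Ordinal jX) => //; rewrite mem_enum.
  rewrite -LMD; apply: subvP (addvSl _ _) _ _.
  apply: memv_suml => k _; apply: memvZ.
  by rewrite (basis_mem (vbasisP D)) // mem_nth ?size_tuple.
have := dimvS Mphi; have := dimvS Nphi.
have := dimv_sum_cap (phi a) L; have := dimv_sum_cap K L.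
by rewrite KLN KLM; lia.
Qed.

End Subspaces.

(* The truncated subtraction is harmless: [qbin q n k] vanishes for n < k. *)
Fixpoint qbin (q n k : nat) : nat :=
  match n, k with
  | _, 0 => 1
  | 0, _.+1 => 0
  | n'.+1, k'.+1 => qbin q n' k + q ^ (n' - k') * qbin q n' k'
  end.

(** * Counting subspaces of given codimension by q-binomial coefficients *)

Section Counting.
Variables (F : finFieldType) (V : vectType F).
Implicit Types (U W K L M N S : {vspace V}).
Local Notation q := #|F|.

(** This follows the recursion of [qbin]. Enlarge [L] by a line to [L1]: the subspaces containing
    [L1] give the first term. Each other [K] meets [L1] in [L], so [K + L1] has codimension one
    less, and relative complements bound the fibers of this map. *)
Lemma card_codim_le L S k : (L <= S)%VS ->
  (#|[set K : {vspace V} | (L <= K <= S)%VS && (\dim K + k == \dim S)%N]|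
   <= qbin q (\dim S - \dim L) k)%N.
Proof.
move: {2}(\dim S - \dim L)%N (erefl (\dim S - \dim L)%N) => n.
elim: n L k => [|n IHn] L k dn LS.
  rewrite dn; have LE : L = S by apply/eqP; rewrite eqEdim LS; lia.
  have sub : [set K : {vspace V} | (L <= K <= S)%VS && (\dim K + k == \dim S)%N]
      \subset (if k is 0 then [set S] else set0).
    apply/subsetP => K; rewrite inE LE -andbA => /and3P[SK KS /eqP].
    have -> : K = S by apply/eqP; rewrite eqEsubv KS.
    by case: (k) => [|k']; rewrite ?inE ?eqxx //; lia.
  apply: leq_trans (subset_leq_card sub) _.
  by case: (k) => [|k'] /=; rewrite ?cards1 ?cards0.
case: k => [|k].
  rewrite dn /= -(cards1 S); apply: subset_leq_card; apply/subsetP => K.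
  rewrite !inE addn0 -andbA => /and3P[_ KS /eqP dK].
  by rewrite eqEdim KS dK leqnn.
have /subvPn[x xS xL] : ~~ (S <= L)%VS by apply/negP => /dimvS; lia.
set L1 := (L + <[x]>)%VS.
have dL1 : \dim L1 = (\dim L).+1 by exact: dimv_add_line.
have L1S : (L1 <= S)%VS by rewrite subv_add LS -memvE.
have dn1 : (\dim S - \dim L1)%N = n by rewrite dL1; lia.
rewrite dn /=.
set A := [set K | _].
rewrite -(cardsID [set K | L1 <= K]%VS A); apply: leq_add.
  rewrite -[n in leqRHS]dn1; apply: leq_trans _ (IHn L1 k.+1 dn1 L1S).
  apply: subset_leq_card; apply/subsetP => K; rewrite !inE.
  by case/andP=> /andP[/andP[_ ->] ->] ->.
rewrite mulnC; set B := _ :\: _.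
pose Z := [set K : {vspace V} | (L1 <= K <= S)%VS && (\dim K + k == \dim S)%N].
have BP K : K \in B -> [/\ (K :&: L1 = L)%VS, (L <= K <= S)%VS &
    (\dim K + k.+1 = \dim S)%N].
  rewrite !inE => /andP[L1K /andP[LKS /eqP dK]]; split=> //.
  apply/eqP; rewrite eq_sym eqEdim subv_cap; have [-> _] := andP LKS.
  rewrite addvSl /=.
  suff : (\dim (K :&: L1) < \dim L1)%N by lia.
  rewrite ltn_neqAle dimvS ?capvSr // andbT.
  by rewrite (dimv_leqif_eq (capvSr _ _)); apply: contra L1K => /eqP/capv_idPr.
have fBZ : {in B, forall K, (K + L1)%VS \in Z}.
  move=> K /BP[KL1 /andP[LK KS] dK]; rewrite inE addvSr subv_add KS L1S /=.
  by have := dimv_sum_cap K L1; rewrite KL1 dL1; lia.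
apply: leq_trans (card_fiber_le (N := q ^ (n - k)) fBZ _) _; last first.
  by rewrite leq_mul2r -dn1 IHn ?orbT.
move=> N; rewrite inE => /andP[/andP[L1N NS] /eqP dN].
apply: leq_trans (_ : _ <= #|[set K : {vspace V} |
    (K :&: L1 == L)%VS && (K + L1 == N)%VS]|)%N _.
  apply: subset_leq_card; apply/subsetP => K; rewrite [in X in X -> _]inE.
  by case/andP=> /BP[KL1 _ _] KN; rewrite inE KL1 eqxx.
apply: leq_trans (card_relative_complements _ _ _) _.
by rewrite dL1 leq_exp2l ?finNzRing_gt1 //; lia.
Qed.

(** The map from [K] to [(K :&: L, K + L)] explains the three factors: [K :&: L] has codimension [c]
    in [L], [K + L] has codimension [k - c] in [S], and the fibers consist of relative
    complements. *)
Lemma card_codim_cap_le L S k c : (L <= S)%VS -> (c <= k)%N ->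
  (#|[set K : {vspace V} | [&& (K <= S)%VS, (\dim K + k == \dim S)%N
       & (\dim (K :&: L) + c == \dim L)%N]]|
   <= qbin q (\dim L) c * qbin q (\dim S - \dim L) (k - c)
      * q ^ ((\dim S - \dim L - (k - c)) * c))%N.
Proof.
move=> LS ck; set A := [set K | _].
pose Z1 := [set M : {vspace V} | (0 <= M <= L)%VS && (\dim M + c == \dim L)%N].
pose Z2 := [set N : {vspace V} |
  (L <= N <= S)%VS && (\dim N + (k - c) == \dim S)%N].
have AP K : K \in A -> [/\ (K <= S)%VS, (\dim K + k = \dim S)%N
    & (\dim (K :&: L) + c = \dim L)%N].
  by rewrite inE => /and3P[? /eqP? /eqP?].
apply: leq_trans (card_fiber_le (f := fun K => (K :&: L, K + L)%VS)
  (Z := setX Z1 Z2) (N := q ^ ((\dim S - \dim L - (k - c)) * c)) _ _) _.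
- move=> K /AP[KS dK dKL]; rewrite !inE /= capvSr addvSr subv_add KS LS sub0v.
  by rewrite dKL eqxx /=; have := dimv_sum_cap K L; lia.
- move=> [M N]; rewrite !inE /= => /andP[/andP[_ /eqP dM] /andP[_ /eqP dN]].
  apply: leq_trans (_ : _ <= #|[set K : {vspace V} |
      (K :&: L == M)%VS && (K + L == N)%VS]|)%N _.
    apply: subset_leq_card; apply/subsetP => K; rewrite !inE.
    by case/andP=> _; rewrite xpair_eqE.
  apply: leq_trans (card_relative_complements _ _ _) _.
  by rewrite leq_exp2l ?finNzRing_gt1 // leq_mul //; lia.
rewrite cardsX leq_mul2r; apply/orP; right; apply: leq_mul.
  by have := card_codim_le c (sub0v L); rewrite dimv0 subn0.
exact: card_codim_le.
Qed.

End Counting.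

(** * Forms and totally singular subspaces *)

(* What the three kinds of forms have in common: [kappa] is 1, q or sqrt q for
   quadratic, alternating and Hermitian forms, respectively. *)
Record polar_axioms (F : finFieldType) (m : nat) (theta : F -> F)
    (b : 'rV[F]_m -> 'rV[F]_m -> F) (sing : pred 'rV[F]_m) (kappa : nat) :
    Prop := PolarAxioms {
  pa_linl : forall v a (u w : 'rV[F]_m), b (a *: u + w) v = a * b u v + b w v;
  pa_linr : forall u a (v w : 'rV[F]_m), b u (a *: v + w) = theta a * b u v + b u w;
  pa_theta0 : theta 0 = 0;
  pa_surj : forall c, exists a, theta a = c;
  pa_refl : forall u v, b u v = 0 -> b v u = 0;
  pa_sing0 : sing 0;
  pa_singP : forall a u v, sing u -> sing v -> b u v = 0 -> sing (a *: u + v);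
  pa_nondeg : forall v, sing v -> (forall u, b u v = 0) -> v = 0;
  pa_count : forall e v, sing e -> b v e != 0 ->
    (#|[set a : F | sing (v + a *: e)%R]| <= kappa)%N }.

Section Polar.
Variables (F : finFieldType) (m : nat) (theta : F -> F).
Local Notation V := 'rV[F]_m.
Variables (b : V -> V -> F) (sing : pred V) (kappa : nat).
Hypothesis PA : polar_axioms theta b sing kappa.
Implicit Types (U W E G H K L S y : {vspace V}).
Local Notation q := #|F|.

Lemma pform0l v : b 0 v = 0.
Proof.
have := pa_linl PA v 1 0 0; rewrite scale1r addr0 mul1r => /eqP.
by rewrite -subr_eq subrr => /eqP <-.
Qed.

Lemma pform0r v : b v 0 = 0. Proof. exact: (pa_refl PA (pform0l v)). Qed.

Lemma pformDl u w v : b (u + w) v = b u v + b w v.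
Proof. by have := pa_linl PA v 1 u w; rewrite scale1r mul1r. Qed.

Lemma pformZl a u v : b (a *: u) v = a * b u v.
Proof. by have := pa_linl PA v a u 0; rewrite pform0l !addr0. Qed.

Lemma pformNl u v : b (- u) v = - b u v.
Proof. by rewrite -scaleN1r pformZl mulN1r. Qed.

Lemma pformZr a u v : b u (a *: v) = theta a * b u v.
Proof. by have := pa_linr PA u a v 0; rewrite pform0r !addr0. Qed.

Lemma pformDr u v w : b u (v + w) = b u v + b u w.
Proof.
have t1 : theta 1 * b u v = b u v.
  by have := pa_linr PA u 1 v 0; rewrite pform0r !addr0 scale1r.
by have := pa_linr PA u 1 v w; rewrite scale1r t1.
Qed.

Lemma pform_sumr (I : finType) u (c : I -> F) (f : I -> V) :
  b u (\sum_i c i *: f i) = \sum_i theta (c i) * b u (f i).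
Proof.
rewrite (big_morph (b u) (pformDr u) (pform0r u)).
by apply: eq_bigr => i _; exact: pformZr.
Qed.

Lemma pform_suml (I : finType) u (c : I -> F) (f : I -> V) :
  b (\sum_i c i *: f i) u = \sum_i c i * b (f i) u.
Proof.
rewrite (big_morph (b^~ u) (fun v w => pformDl v w u) (pform0l u)).
by apply: eq_bigr => i _; exact: pformZl.
Qed.

Definition tsing U : bool :=
  [forall u in U, sing u && [forall v in U, b u v == 0]].

Lemma tsingP U : reflect
  ({in U, forall u, sing u} /\ {in U &, forall u v, b u v = 0}) (tsing U).
Proof.
apply: (iffP forallP) => [ts|[s ts] u].
  split=> [u uU|u v uU vU]; have := implyP (ts u) uU => /andP[] //.
  by move=> _ /forallP/(_ v)/implyP/(_ vU)/eqP.
apply/implyP => uU; rewrite s //=; apply/forallP => v.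
by apply/implyP => vU; rewrite ts.
Qed.

Lemma tsingS U W : (U <= W)%VS -> tsing W -> tsing U.
Proof.
move=> /subvP UW /tsingP[s ts]; apply/tsingP.
by split=> [u /UW|u v /UW uW /UW]; [exact: s | exact: ts].
Qed.

Lemma tsingD U W : tsing U -> tsing W ->
  {in U & W, forall u w, b u w = 0} -> tsing (U + W).
Proof.
move=> /tsingP[sU bU] /tsingP[sW bW] bUW; apply/tsingP; split.
  move=> _ /memv_addP[u uU [w wW ->]]; rewrite -[u]scale1r.
  by apply: (pa_singP PA); [exact: sU | exact: sW | exact: bUW].
move=> _ _ /memv_addP[u uU [w wW ->]] /memv_addP[u' uU' [w' wW' ->]].
have bWU w1 u1 : w1 \in W -> u1 \in U -> b w1 u1 = 0.
  by move=> wW1 uU1; apply: (pa_refl PA); rewrite bUW.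
rewrite pformDl !pformDr (bU _ _ uU uU') (bUW _ _ uU wW') (bWU _ _ wW uU').
by rewrite (bW _ _ wW wW') !addr0.
Qed.

Lemma tsing_line v : sing v -> b v v = 0 -> tsing <[v]>.
Proof.
move=> sv bv; apply/tsingP; split.
  move=> _ /vlineP[k ->]; rewrite -[_ *: _]addr0.
  by apply: (pa_singP PA); [| exact: pa_sing0 PA | exact: pform0r].
by move=> _ _ /vlineP[k ->] /vlineP[l ->]; rewrite pformZl pformZr bv !mulr0.
Qed.

(** The form is linear on the left even in the Hermitian case, so pairing with a basis of [U] on the
    right makes the perp the kernel of a matrix. *)
Definition gram U : 'M[F]_(m, \dim U) :=
  \matrix_(i, j) b (delta_mx 0 i) (vbasis U)`_j.

Lemma gramE U v j : (v *m gram U) 0 j = b v (vbasis U)`_j.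
Proof.
rewrite mxE {2}(row_sum_delta v) pform_suml.
by apply: eq_bigr => i _; rewrite mxE.
Qed.

Definition perp U : {vspace V} := lker (linfun (mulmxr (gram U))).

Lemma perpP U v : reflect {in U, forall u, b v u = 0} (v \in perp U).
Proof.
rewrite memv_ker lfunE /=; apply: (iffP eqP) => [vU u uU|vU].
  rewrite (coord_vbasis uU) pform_sumr big1 // => i _.
  by rewrite -gramE vU mxE mulr0.
apply/rowP => j; rewrite gramE mxE vU //.
by rewrite (basis_mem (vbasisP U)) // mem_nth ?size_tuple.
Qed.

Lemma dim_cap_perp U W : (\dim W <= \dim (W :&: perp U) + \dim U)%N.
Proof.
rewrite -(limg_ker_dim (linfun (mulmxr (gram U))) W) leq_add2l.
by apply: leq_trans (dimvS (subvf _)) _; rewrite dimvf dim_matrix mul1r.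
Qed.

(** The basis of [U] has to induce independent functionals. By surjectivity of [theta], a relation
    between them comes from a vector of [U] orthogonal to the whole space; it is singular, so
    nondegeneracy makes it zero. *)
Lemma dim_perp U : tsing U -> (\dim (perp U) + \dim U = m)%N.
Proof.
move=> /tsingP[sU bU].
have dV : \dim {: V} = m by rewrite dimvf dim_matrix mul1r.
have := limg_ker_dim (linfun (mulmxr (gram U))) {: V}.
rewrite (capv_idPr (subvf _)) -/(perp U) dV => dim_sum.
apply: etrans dim_sum; congr addn.
have rf : row_free (gram U)^T.
  apply: inj_row_free => c cN; apply/rowP => j; rewrite [RHS]mxE.
  have /fin_all_exists[a aP] : forall j, exists a, theta a = c 0 j.
    by move=> i; apply: pa_surj PA _.
  have uU : \sum_j a j *: (vbasis U)`_j \in U.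
    apply: memv_suml => i _; apply: memvZ.
    by rewrite (basis_mem (vbasisP U)) // mem_nth ?size_tuple.
  have u0 : \sum_j a j *: (vbasis U)`_j = 0.
    apply: (pa_nondeg PA); rewrite ?sU // => v.
    rewrite pform_sumr; transitivity ((c *m (gram U)^T *m v^T) 0 0).
      rewrite -mulmxA -trmx_mul mxE; apply: eq_bigr => i _.
      by rewrite aP [in RHS]mxE gramE.
    by rewrite cN mul0mx mxE.
  have /freeP/(_ a u0 j) aj := basis_free (vbasisP U).
  by rewrite -aP aj (pa_theta0 PA).
have /row_fullP[B BN] : row_full (gram U).
  by rewrite /row_full -mxrank_tr; exact: rf.
set f : 'Hom(V, 'rV[F]_(\dim U)) := linfun _.
suff -> : limg f = fullv by rewrite dimvf dim_matrix mul1r.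
apply/vspaceP => w; rewrite memvf; apply/memv_imgP; 
exists (w *m B); rewrite ?memvf // lfunE /=.
by rewrite -mulmxA BN mulmx1.
Qed.

End Polar.

(** * Generators *)

(* [move:] also identifies dimensions that are only convertible. *)
Ltac dimlia :=
  repeat match goal with
  | |- context [dimv ?U] => let n := fresh "n" in move: (dimv U) => n
  end; clear; lia.

Section Generators.
Variables (F : finFieldType) (m : nat) (theta : F -> F).
Local Notation V := 'rV[F]_m.
Variables (b : V -> V -> F) (sing : pred V) (kappa : nat).
Hypothesis PA : polar_axioms theta b sing kappa.
Variables (d e : nat).
Local Notation tsing := (tsing b sing).
Local Notation perp := (perp b).
Hypothesis rank_le : forall U : {vspace V}, tsing U -> (\dim U <= d)%N.
Hypothesis rank_ex : exists2 U : {vspace V}, tsing U & \dim U = d.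
Hypothesis dim_ambient : m = (2 * d + e)%N.
Implicit Types (U W E G H K L S y h : {vspace V}).
Local Notation q := #|F|.

(** Generators are handled through their dimension; [gen_maximal] identifies them with the maximal
    totally singular subspaces. *)
Definition gen U : bool := tsing U && (\dim U == d).

Lemma genP U : reflect (tsing U /\ \dim U = d) (gen U).
Proof. by apply: (iffP andP) => -[ts /eqP]. Qed.

Lemma gen_eq_sub y y' : gen y -> gen y' -> (y <= y')%VS -> y = y'.
Proof.
move=> /genP[_ dy] /genP[_ dy'] yy'; apply/eqP.
by rewrite eqEdim yy' dy dy' leqnn.
Qed.

(** By dimension, the part of [W] orthogonal to a complement of [U :&: W] in [U] is larger than
    [U :&: W]. A vector [w] of it outside [U] is also orthogonal to [U :&: W], since [W] is totally
    singular, and hence to all of [U]. *)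
Lemma tsing_extend U W : tsing U -> tsing W -> (\dim U < \dim W)%N ->
  exists2 w, w \notin U & tsing (U + <[w]>).
Proof.
move=> tU tW UW; have [/(tsingP)[_ bU] /(tsingP)[sW bW]] := (tU, tW).
have := dim_cap_perp b (U :\: W) W; have := dimv_cap_compl U W => dU dW.
have /subvPn[w] : ~~ (W :&: perp (U :\: W) <= U :&: W)%VS.
  by apply/negP => /dimvS; move: dU dW UW; dimlia.
rewrite !memv_cap => /andP[wW /(perpP PA) wU]; rewrite wW andbT => wnU.
exists w => //; apply: (tsingD PA) => //.
  by apply: (tsing_line PA); rewrite ?sW ?bW.
move=> u _ uU /vlineP[k ->]; rewrite (pformZr PA).
suff -> : b u w = 0 by rewrite mulr0.
move: uU; rewrite -(addv_diff_cap U W) => /memv_addP[u1 u1U [u2 u2W ->]].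
rewrite (pformDl PA) (pa_refl PA (wU _ u1U)) add0r.
by move: u2W; rewrite memv_cap => /andP[_ u2W]; rewrite bW.
Qed.

Lemma gen_maximal U :
  gen U = tsing U && [forall W, tsing W && (U <= W)%VS ==> (W == U)].
Proof.
apply/genP/andP => -[tU UP]; split=> //.
  apply/forallP => W; apply/implyP => /andP[tW UW].
  by rewrite eq_sym eqEdim UW UP rank_le.
have [W tW dW] := rank_ex.
apply/eqP; rewrite eqn_leq rank_le // leqNgt; apply/negP => dU.
have [w wU tUw] := tsing_extend tU tW ltac:(by rewrite dW).
have := forallP UP (U + <[w]>)%VS; rewrite tUw addvSl /= => /eqP UwU.
by case/negP: wU; rewrite -UwU (subvP (addvSr _ _)) ?memv_line.
Qed.

Lemma gen_perp y : gen y -> (y <= perp y)%VS.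
Proof.
move=> /genP[/tsingP[_ by0] _]; apply/subvP => v vy; apply/(perpP PA) => u uy.
exact: by0.
Qed.

(** The first two terms lie in [y1]; each of them shares [y2] or [y3] with the third term, which
    makes it orthogonal to that term. *)
Lemma tsing_pairwise_cap y1 y2 y3 : tsing y1 -> tsing y2 -> tsing y3 ->
  tsing (y1 :&: y2 + y1 :&: y3 + y2 :&: y3).
Proof.
move=> t1 t2 t3; have [[_ b2] [_ b3]] := (tsingP _ _ _ t2, tsingP _ _ _ t3).
apply: (tsingD PA).
- apply: tsingS t1; by rewrite subv_add !capvSl.
- exact: tsingS (capvSl _ _) t2.
move=> _ w /memv_addP[u /memv_capP[_ u2] [v /memv_capP[_ v3] ->]].
by move=> /memv_capP[w2 w3]; rewrite (pformDl PA) b2 // b3 // addr0.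
Qed.

Lemma gen_triple y1 y2 y3 : gen y1 -> gen y2 -> gen y3 ->
  (\dim (y1 :&: y2) + \dim (y1 :&: y3) + \dim (y2 :&: y3)
   <= d + 2 * \dim (y1 :&: y2 :&: y3))%N.
Proof.
move=> /genP[t1 _] /genP[t2 _] /genP[t3 _]; rewrite -dimv_pairwise_cap leq_add2r.
by rewrite rank_le ?tsing_pairwise_cap.
Qed.

(** Write [y' = h + <[x]>]. Each such [y] is spanned by [h] and a vector [v] with [b v x = 1].
    Modulo [h], [v] differs from a fixed [v1] by a vector of a complement [D] of [y'] in its perp,
    of dimension [m - 2 * d = e], plus a multiple of [x]. There are [q ^ e] choices in [D], and
    [pa_count] allows at most [kappa] multiples for each. *)
Lemma card_gen_over_hyperplane h y' :
  gen y' -> (h <= y')%VS -> (\dim h).+1 = d ->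
  (#|[set y | [&& gen y, h <= y & y != y']%VS]| <= q ^ e * kappa)%N.
Proof.
move=> gy' hy' dh; set X := [set y | _].
have [->|[y1 y1X]] := set_0Vmem X; first by rewrite cards0.
have [ty' dy'] := genP _ gy'; have [sy' by'] := tsingP _ _ _ ty'.
have /subvPn[x xy' xh] : ~~ (y' <= h)%VS.
  by apply/negP => /dimvS; move: dy' dh; dimlia.
have y'E : y' = (h + <[x]>)%VS.
  apply/eqP; rewrite eq_sym eqEdim subv_add hy' -memvE xy' dimv_add_line //.
  by rewrite dy' dh leqnn.
have XP y : y \in X ->
    (* If [x] were orthogonal to [y], then [y + <[x]>] would be totally singular; the rank bound
       would put [x] in [y] and force [y = y']. *)
    [/\ gen y, (h <= y)%VS & exists2 v, v \in y & b v x = 1].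
  rewrite inE => /and3P[gy hy yy']; split=> //.
  have [ty dy] := genP _ gy.
  have [/existsP[v /andP[vy bv]]|] := boolP [exists v in y, b v x != 0].
    exists ((b v x)^-1 *: v); first by rewrite memvZ.
    by rewrite (pformZl PA) mulVf.
  rewrite negb_exists => /forallP bx; case/negP: yy'.
  have txy : tsing (y + <[x]>).
    apply: (tsingD PA) => //; first by apply: (tsing_line PA); rewrite ?sy' ?by'.
    move=> u _ uy /vlineP[k ->]; rewrite (pformZr PA).
    by have := bx u; rewrite uy /= negbK => /eqP->; rewrite mulr0.
  have xy : x \in y.
    apply: contraT => xny; have := rank_le txy.
    by rewrite dimv_add_line // dy ltnn.
  rewrite eq_sym; apply/eqP; apply: gen_eq_sub => //.
  by rewrite y'E subv_add hy -memvE.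
have [gy1 hy1 [v1 v1y1 bv1]] := XP _ y1X.
set D := (perp y' :\: y')%VS.
have py' : (y' <= perp y')%VS by exact: gen_perp.
have dD : \dim D = e.
  have := dimv_cap_compl (perp y') y'; have := dim_perp PA ty'.
  by rewrite (capv_idPr py') -/D dy'; move: dim_ambient; dimlia.
pose del (c : 'rV[F]_(\dim D)) := \sum_k c 0 k *: (vbasis D)`_k.
have delD c : del c \in perp y'.
  apply: (subvP (diffvSl _ y')); apply: memv_suml => k _; apply: memvZ.
  by rewrite (basis_mem (vbasisP D)) // mem_nth ?size_tuple.
pose Z := [set p : 'rV[F]_(\dim D) * F | sing (v1 + del p.1 + p.2 *: x)].
pose phi (p : 'rV[F]_(\dim D) * F) : {vspace V} :=
  (h + <[v1 + del p.1 + p.2 *: x]>)%VS.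
have XZ : X \subset phi @: Z.
  apply/subsetP => y yX; have [gy hy [v vy bv]] := XP _ yX.
  have [[ty dy] [ty1 _]] := (genP _ gy, genP _ gy1).
  have [[sy by0] [_ by1]] := (tsingP _ _ _ ty, tsingP _ _ _ ty1).
  (* Both vectors pair to 1 with [x] and to 0 with [h]. *)
  have : v - v1 \in perp y'.
    apply/(perpP PA) => u; rewrite y'E => /memv_addP[u1 u1h [_ /vlineP[k ->] ->]].
    rewrite (pformDr PA) (pformZr PA) !(pformDl PA) !(pformNl PA) bv bv1 subrr mulr0.
    by rewrite by0 // ?(subvP hy) // by1 ?subrr ?addr0 // (subvP hy1).
  rewrite -{1}(addv_diff_cap (perp y') y') (capv_idPr py') -/D {1}y'E.
  move=> /memv_addP[u uD [_ /memv_addP[u1 u1h [_ /vlineP[k ->] ->]] vE]].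
  pose c := \row_i coord (vbasis D) i u.
  have delc : del c = u.
    by rewrite [RHS](coord_vbasis uD); apply: eq_bigr => i _; rewrite mxE.
  have wE : v1 + u + k *: x = v - u1.
    have -> : v = v1 + (u + (u1 + k *: x)) by rewrite -vE addrC subrK.
    by rewrite (addrCA u) (addrCA v1) [RHS]addrAC subrr add0r addrA.
  have wy : v1 + u + k *: x \in y by rewrite wE memvB // (subvP hy).
  apply/imsetP; exists (c, k); first by rewrite inE /= delc sy.
  rewrite /phi /= delc; apply/eqP; rewrite eq_sym eqEdim subv_add hy -memvE wy /=.
  rewrite dimv_add_line ?dy ?dh ?leqnn //; apply/negP => wh.
  have /eqP := by' _ _ (subvP hy' _ wh) xy'.
  rewrite wE (pformDl PA) (pformNl PA) bv by' ?subr0 ?oner_eq0 //.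
  exact: (subvP hy').
apply: leq_trans (subset_leq_card XZ) _; apply: leq_trans (leq_imset_card _ _) _.
have -> : (q ^ e = #|[set: 'rV[F]_(\dim D)]|)%N by rewrite cardsT card_mx mul1n dD.
apply: (card_fiber_le (f := fst)) => [p _|c _]; first by rewrite inE.
apply: leq_trans (pa_count PA (e := x) (v := v1 + del c) _ _); last 2 first.
- exact: sy'.
- by rewrite (pformDl PA) bv1 (perpP PA _ _ (delD c)) // addr0 oner_eq0.
rewrite -(card_imset _ (_ : injective (fun a : F => (c, a)))); last first.
  by move=> a a' [].
apply: subset_leq_card; apply/subsetP => -[c' a]; rewrite !inE /=.
case/andP=> s /eqP cE; rewrite cE in s *.
by apply/imsetP; exists a; rewrite ?inE.
Qed.

(** Induction on [s]. Enlarge [E] by a line of [G] to [E'], and send [y] to the generator [f y],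
    which meets [G] in [E'] and shares with [y] the hyperplane [hy y]. Given [f y], relative
    complements leave [q ^ s] hyperplanes, and each lies in at most [q ^ e * kappa] other
    generators. *)
Lemma card_gen_cap G E s : gen G -> (E <= G)%VS -> (\dim E + s = d)%N ->
  (#|[set y | gen y && (y :&: G == E)%VS]|
   <= (q ^ e * kappa) ^ s * q ^ 'C(s, 2))%N.
Proof.
move=> gG; have [tG dG] := genP _ gG.
elim: s E => [|s IHs] E EG dE.
  rewrite expn0 mul1n bin0n /= expn0.
  apply: leq_trans (_ : #|[set G]| <= _)%N; last by rewrite cards1.
  apply: subset_leq_card; apply/subsetP => y; rewrite !inE => /andP[gy /eqP yG].
  have EGE : E = G by apply/eqP; rewrite eqEdim EG dG -dE addn0 leqnn.
  apply/eqP; symmetry; apply: gen_eq_sub => //.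
  by rewrite -[X in (X <= _)%VS]EGE -yG capvSl.
have /subvPn[x xG xE] : ~~ (G <= E)%VS.
  by apply/negP => /dimvS; move: dE dG; dimlia.
set E' := (E + <[x]>)%VS.
have dE' : \dim E' = (\dim E).+1 by exact: dimv_add_line.
have E'G : (E' <= G)%VS by rewrite subv_add EG -memvE.
pose hy y := (y :&: perp E')%VS.
pose f y := (hy y + E')%VS.
set A := [set y | _]; pose B := [set y | gen y && (y :&: G == E')%VS].
have AP y : y \in A -> [/\ gen y, gen (f y), (f y :&: G = E')%VS,
    (hy y = y :&: f y)%VS & [/\ (\dim (hy y)).+1 = d, (hy y :&: E' = E)%VS
    & y != f y]].
  rewrite inE => /andP[gy /eqP yG]; have [ty dy] := genP _ gy.
  have [_ by0] := tsingP _ _ _ ty; have [_ bG] := tsingP _ _ _ tG.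
  have Ey : (E <= y)%VS by rewrite -yG capvSl.
  have hE' : (hy y :&: E' = E)%VS.
    apply/eqP; rewrite eqEsubv !subv_cap Ey addvSl andbT; apply/andP; split.
      rewrite -[X in (_ <= X)%VS]yG subv_cap (subv_trans (capvSl _ _)) ?capvSl //.
      by rewrite (subv_trans (capvSr _ _)).
    apply/subvP => u uE; apply/(perpP PA) => w wE'; apply: bG.
      exact: (subvP EG).
    exact: (subvP E'G).
  (* The subspace [E] of [y] is already orthogonal to [y], so only the condition of orthogonality to
     [x] remains, which costs at most one dimension. *)
  have dh : (d <= (\dim (hy y)).+1)%N.
    suff : (\dim (y :&: perp <[x]>) <= \dim (hy y))%N.
      have := dim_cap_perp b <[x]> y; rewrite dy dim_vline.
      by case: (x != 0) => /=; dimlia.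
    apply: dimvS; rewrite subv_cap capvSl; apply/subvP => u /memv_capP[uy].
    move=> /(perpP PA) ux; apply/(perpP PA) => _ /memv_addP[w wE [z zx ->]].
    by rewrite (pformDr PA) by0 ?ux ?addr0 // (subvP Ey).
  have tf : tsing (f y).
    apply: (tsingD PA); first exact: tsingS (capvSl _ _) ty.
      exact: tsingS E'G tG.
    by move=> u w /memv_capP[_ /(perpP PA)]; apply.
  have df := dimv_sum_cap (hy y) E'; rewrite hE' -/(f y) dE' in df.
  have df' := rank_le tf.
  have gf : gen (f y) by apply/genP; split=> //; move: dh df df' dE; dimlia.
  have fG : (f y :&: G = E')%VS.
    rewrite /f addvC -vspace_modl //; apply/addv_idPl.
    rewrite (subv_trans _ (addvSl _ _)) // -[X in (_ <= X)%VS]yG.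
    by rewrite capvS ?capvSl.
  have yf : y != f y.
    apply: contra_neq (_ : E != E') => [yfE|]; first by rewrite -yG -fG -yfE.
    by apply: contraNneq xE => ->; rewrite (subvP (addvSr _ _)) ?memv_line.
  have hyf : (hy y <= y :&: f y)%VS by rewrite subv_cap capvSl addvSl.
  split=> //; last by split=> //; move: dh df df' dE; dimlia.
  apply/eqP; rewrite eqEdim hyf /=.
  suff : (\dim (y :&: f y) < d)%N by move: dh; dimlia.
  rewrite -dy ltn_neqAle dimvS ?capvSl // andbT.
  rewrite (dimv_leqif_eq (capvSl _ _)); apply: contra yf => /eqP/capv_idPl yf.
  by apply/eqP; apply: gen_eq_sub.
have fAB : {in A, forall y, f y \in B}.
  by move=> y /AP[_ gf fG _ _]; rewrite inE gf fG eqxx.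
apply: leq_trans (card_fiber_le (N := q ^ s * (q ^ e * kappa)) fAB _) _;
  last first.
  have := IHs E' E'G; rewrite dE' => /(_ ltac:(move: dE; dimlia)) le.
  apply: leq_trans (leq_mul le (leqnn _)) _.
  rewrite binS bin1 expnS expnD [(q ^ s * _)%N]mulnC mulnACA.
  by rewrite [(_ * (q ^ e * kappa))%N]mulnC.
move=> y'; rewrite inE => /andP[gy' /eqP y'G].
have [ty' dy'] := genP _ gy'.
pose Z := [set h : {vspace V} | (h :&: E' == E)%VS && (h + E' == y')%VS].
apply: leq_trans (card_fiber_le (f := hy) (Z := [set h in Z | (\dim h).+1 == d])
  (N := q ^ e * kappa) _ _) _.
- move=> y /setIdP[/AP[_ _ _ _ [dh hE _]] /eqP fy].
  by rewrite !inE hE -/(f y) fy dh !eqxx.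
- move=> h; rewrite !inE => /andP[/andP[_ /eqP hE] /eqP dh].
  apply: leq_trans (card_gen_over_hyperplane gy' _ dh); last first.
    by rewrite -hE addvSl.
  apply: subset_leq_card; apply/subsetP => y.
  case/setIdP=> /setIdP[/AP[gy _ _ hyE [_ _ yf]] /eqP fy] /eqP hyh.
  by rewrite inE gy -hyh capvSl -fy yf.
rewrite leq_mul2r; apply/orP; right.
apply: leq_trans (_ : #|Z| <= _)%N.
  by apply: subset_leq_card; apply/subsetP => h; rewrite !inE => /andP[].
apply: leq_trans (card_relative_complements _ _ _) _.
by rewrite leq_exp2l ?finNzRing_gt1 // dE' dy' subSnn muln1; move: dE; dimlia.
Qed.

End Generators.

(** * EKR sets *)

Lemma card_bigcup_le (I S : finType) (P : pred I) (A : I -> {set S}) :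
  (#|\bigcup_(i | P i) A i| <= \sum_(i | P i) #|A i|)%N.
Proof.
elim/big_rec2: _ => [|i X n _ le]; first by rewrite cards0.
by apply: leq_trans (leq_card_setU _ _) _; rewrite leq_add2l.
Qed.

Section EKR.
Variables (F : finFieldType) (m : nat) (theta : F -> F).
Local Notation V := 'rV[F]_m.
Variables (b : V -> V -> F) (sing : pred V) (kappa : nat).
Hypothesis PA : polar_axioms theta b sing kappa.
Variables (d e : nat).
Local Notation tsing := (tsing b sing).
Local Notation gen := (gen b sing d).
Hypothesis rank_le : forall U : {vspace V}, tsing U -> (\dim U <= d)%N.
Hypothesis dim_ambient : m = (2 * d + e)%N.
Variables (s : nat) (Y : {set {vspace V}}).
Hypothesis ds : (4 * s <= d)%N.
Hypothesis Y_gen : {in Y, forall y, gen y}.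
Hypothesis Y_EKR : {in Y &, forall y1 y2, (d <= \dim (y1 :&: y2) + 2 * s)%N}.
Implicit Types (U W E G H K L S P y h : {vspace V}).
Local Notation q := #|F|.

(** Each counted [y] contains a subspace [P] of [S] of dimension [d - 4 * s + 1], that is, of
    codimension [s - 1] in [S]; a choice of [P] is a map whose fibers have at most [c] elements. *)
Lemma near_card c S :
  (0 < s)%N -> tsing S -> (\dim S + 3 * s = d)%N ->
  (forall P, tsing P -> (\dim P + (4 * s - 1) = d)%N ->
    (#|[set y in Y | P <= y]%VS| <= c)%N) ->
  (#|[set y in Y | d - 4 * s < \dim (y :&: S)]| <= qbin q (d - 3 * s) (s - 1) * c)%N.
Proof.
move=> s0 tS dS cP; set X := [set y in Y | _].
pose A y := [pred P : {vspace V} |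
  (P <= y :&: S)%VS && (\dim P + (4 * s - 1) == d)%N].
(* The default value does not occur on [X], where such a [P] exists. *)
pose f y := odflt 0%VS [pick P in A y].
have fP y : y \in X -> [/\ y \in Y, (f y <= y)%VS, (f y <= S)%VS &
    (\dim (f y) + (4 * s - 1) = d)%N].
  case/setIdP=> yY dyS.
  have [P /andP[_ PyS] dP] : exists2 P, (0 <= P <= y :&: S)%VS &
      \dim P = (d - 4 * s).+1.
    by apply: subv_dim_between; rewrite ?sub0v // dimv0.
  rewrite /f; case: pickP => [Q /andP[]|/(_ P)] /=.
    by rewrite subv_cap => /andP[Qy QS] /eqP.
  by rewrite inE PyS dP; move: ds s0; clear; lia.
pose Z := [set P : {vspace V} | (0 <= P <= S)%VS &&
  (\dim P + (s - 1) == \dim S)%N].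
apply: leq_trans (card_fiber_le (f := f) (Z := Z) (N := c) _ _) _.
- move=> y /fP[_ _ fS df]; rewrite inE sub0v fS /=.
  by move: df dS s0 ds; dimlia.
- move=> P; rewrite inE => /andP[/andP[_ PS] /eqP dP].
  apply: leq_trans (cP P (tsingS PS tS) _); last by move: dP dS s0 ds; dimlia.
  apply: subset_leq_card; apply/subsetP => y.
  by case/setIdP=> /fP[yY fy _ _] /eqP fyP; rewrite inE yY -fyP.
rewrite leq_mul2r; apply/orP; right.
have -> : (d - 3 * s)%N = \dim S by move: dS; dimlia.
by have := card_codim_le (s - 1) (sub0v S); rewrite dimv0 subn0.
Qed.

Lemma EKR_triple : {in Y & &, forall y1 y2 y3,
  (d <= \dim (y1 :&: y2 :&: y3) + 3 * s)%N}.
Proof.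
move=> y1 y2 y3 Y1 Y2 Y3.
have := gen_triple PA rank_le (Y_gen Y1) (Y_gen Y2) (Y_gen Y3).
move: (Y_EKR Y1 Y2) (Y_EKR Y1 Y3) (Y_EKR Y2 Y3); dimlia.
Qed.

(** * Three members of [Y] meeting in the least possible dimension [d - 3 * s] *)

Section Far.
Variables (y1 y2 y3 : {vspace V}).
Hypotheses (Y1 : y1 \in Y) (Y2 : y2 \in Y) (Y3 : y3 \in Y).
Hypothesis dS : (\dim (y1 :&: y2 :&: y3) + 3 * s = d)%N.
Let S := (y1 :&: y2 :&: y3)%VS.
Let G := (y1 :&: y2 + y1 :&: y3 + y2 :&: y3)%VS.

(** The dimension of [G] is at least [3 (d - 2s) - 2 (d - 3s) = d]. *)
Lemma center_gen : gen G.
Proof.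
have [[t1 _] [t2 _] [t3 _]] := And3 (genP _ _ _ _ (Y_gen Y1))
  (genP _ _ _ _ (Y_gen Y2)) (genP _ _ _ _ (Y_gen Y3)).
have tG : tsing G by apply: (tsing_pairwise_cap PA).
apply/genP; split=> //.
have := dimv_pairwise_cap y1 y2 y3; rewrite -/G.
move: (Y_EKR Y1 Y2) (Y_EKR Y1 Y3) (Y_EKR Y2 Y3) (rank_le tG) dS; dimlia.
Qed.

Lemma center_sub : (S <= G)%VS.
Proof.
apply: subv_trans (addvSr _ _); rewrite /S subv_cap capvSr andbT.
by rewrite (subv_trans (capvSl _ _)) ?capvSr.
Qed.

(** The three subspaces [y :&: (yi :&: yj)] of [y :&: G] have dimension at least [d - 3s], so their
    sum has dimension at least [3 (d - 3s) - 2 (d - 4s) = d - s]. *)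
Lemma far_center y : y \in Y -> (\dim (y :&: S) <= d - 4 * s)%N ->
  (d <= \dim (y :&: G) + s)%N.
Proof.
move=> Yy dyS; have := dimv_pairwise_cap (y :&: y1) (y :&: y2) (y :&: y3).
have cE u v : (y :&: u :&: (y :&: v) = y :&: (u :&: v))%VS.
  by apply/vspaceP => x; rewrite !memv_cap; do 3!case: (x \in _).
rewrite !cE -/S => dsum.
have le : (y :&: (y1 :&: y2) + y :&: (y1 :&: y3) + y :&: (y2 :&: y3)
    <= y :&: G)%VS.
  rewrite !subv_add !subv_cap !capvSl /= -andbA.
  apply/and3P; split; apply: subv_trans (capvSr _ _) _.
  - exact: subv_trans (addvSl _ _) (addvSl _ _).
  - exact: subv_trans (addvSr _ _) (addvSl _ _).
  - exact: addvSr.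
have triple u v : u \in Y -> v \in Y -> (d <= \dim (y :&: (u :&: v)) + 3 * s)%N.
  by move=> Yu Yv; rewrite capvA EKR_triple.
move: (dimvS le) dsum dyS ds (triple _ _ Y1 Y2) (triple _ _ Y1 Y3).
by move: (triple _ _ Y2 Y3); dimlia.
Qed.

(** Three nested counts: [K = y :&: S], then [E = y :&: G] given [K], then [y] given [E]. The
    exceptional member [y0] restricts the possible [K]. *)
Lemma far_card y0 : y0 \in Y -> (\dim (y0 :&: G) + s < d)%N ->
  (#|[set y in Y | \dim (y :&: S) <= d - 4 * s]| <=
   (q ^ e * kappa) ^ s * q ^ 'C(s, 2) *
   (q ^ (3 * s ^ 2) * \sum_(1 <= i < s)
     q ^ ((s - 1 - i) * (s - i)) * qbin q (d - 4 * s + 1) (s - i)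
       * qbin q (s - 1) i))%N.
Proof.
move=> Yy0 dy0; set X := [set y in Y | _].
have [tG dG] := genP _ _ _ _ center_gen; have SG := center_sub.
(* By [far_center], [y0] cannot meet [S] in dimension at most [d - 4 * s], so there is room for
   [L]. *)
have [L /andP[_]] : exists2 L, (0 <= L <= y0 :&: S)%VS &
    \dim L = (d - 4 * s).+1.
  apply: subv_dim_between; rewrite ?sub0v // dimv0 /= ltnNge.
  by apply/negP => /(far_center Yy0); rewrite leqNgt dy0.
rewrite subv_cap => /andP[Ly0 LS] dL.
have XP y : y \in X -> [/\ (\dim (y :&: S) + 4 * s = d)%N,
    (\dim (y :&: G) + s = d)%N, (y :&: G :&: S = y :&: S)%VS,
    (y :&: G + S = G)%VS & (\dim L < \dim (y :&: S :&: L) + s)%N].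
  case/setIdP=> Yy dyS; have dyG := far_center Yy dyS.
  have yGS : (y :&: G :&: S = y :&: S)%VS by rewrite -capvA (capv_idPr SG).
  have sub : (y :&: G + S <= G)%VS by rewrite subv_add capvSr.
  (* The sum of [y :&: G] and [S] has dimension at least [(d - s) + (d - 3s) - (d - 4s) = d] inside
     [G], so all these estimates are equalities. *)
  have := dimv_sum_cap (y :&: G) S; have := dimvS sub; rewrite yGS dG => l1 l2.
  have dS' : (\dim S + 3 * s = d)%N by exact: dS.
  split=> //; try by move: l1 l2 dyS dyG dS' ds; dimlia.
    by apply/eqP; rewrite eqEdim sub dG /=; move: l1 l2 dyS dyG dS' ds; dimlia.
  have LH : (y :&: G :&: (y0 :&: G) + L <= y0 :&: G)%VS.
    by rewrite subv_add capvSr subv_cap Ly0 (subv_trans LS).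
  have ELE : (y :&: G :&: (y0 :&: G) :&: L = y :&: S :&: L)%VS.
    apply/vspaceP => x; rewrite (memv_cap _ _ L) [RHS]memv_cap.
    case xL: (x \in L); rewrite ?andbF // (memv_cap _ y S) (subvP LS) //.
    rewrite (memv_cap _ (y :&: G)) !(memv_cap _ _ G) (subvP Ly0) //.
    by rewrite (subvP SG) ?(subvP LS) // !andbT.
  (* With [g = \dim (y0 :&: G)], this gives [2 * \dim (y :&: G :&: y0) >= d - 3s + g]. Adding [L]
     inside [y0 :&: G] and using [g < d - s] bounds the codimension of [y :&: S :&: L] in [L] below
     [s]. *)
  have tri := gen_triple PA rank_le (Y_gen Yy) center_gen (Y_gen Yy0).
  have yGy0 : (y :&: G :&: y0 = y :&: G :&: (y0 :&: G))%VS.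
    apply/vspaceP => x; rewrite !memv_cap.
    by do 3!case: (x \in _).
  have := dimv_sum_cap (y :&: G :&: (y0 :&: G)) L; rewrite ELE.
  have := Y_EKR Yy Yy0; move: (dimvS LH) tri dy0; rewrite yGy0 (capvC G y0).
  by move: dyG; dimlia.
pose Z i := [set K : {vspace V} | [&& (K <= S)%VS, (\dim K + s == \dim S)%N
       & (\dim (K :&: L) + (s - i) == \dim L)%N]].
have dS' : (\dim S + 3 * s = d)%N by exact: dS.
apply: leq_trans (card_fiber_le (f := fun y => (y :&: S)%VS)
  (Z := \bigcup_(i < s | (0 < i)%N) Z i)
  (N := q ^ (3 * s ^ 2) * ((q ^ e * kappa) ^ s * q ^ 'C(s, 2))) _ _) _.
- move=> y /XP[d1 d2 _ _ d3].
  have d4 := dimvS (capvSl (y :&: S) L).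
  have d5 := dimvS (capvSr (y :&: S) L).
  (* Here [0 < i] is the codimension bound from [XP], and [i < s] holds because
     [\dim (y :&: S) = d - 4 * s] is less than [\dim L]. *)
  have [i ilt iP] : exists2 i, (0 < i < s)%N &
      (\dim (y :&: S :&: L) + (s - i) = \dim L)%N.
    exists (\dim (y :&: S :&: L) + s - \dim L)%N;
      by move: d1 d3 d4 d5 dL ds; dimlia.
  have [i0 is'] := andP ilt.
  apply/bigcupP; exists (Ordinal is') => //; rewrite inE capvSr /=.
  by move: d1 iP dS' ds; rewrite /=; dimlia.
- move=> K KZ; have [dK] : (\dim K + 4 * s = d)%N.
    case/bigcupP: KZ => i _; rewrite inE => /and3P[_ /eqP dK _].
    by move: dK dS'; dimlia.
  apply: leq_trans (card_fiber_le (f := fun y => (y :&: G)%VS)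
    (Z := [set E | (E :&: S == K)%VS && (E + S == G)%VS] :&:
          [set E | (E <= G)%VS && (\dim E + s == d)%N])
    (N := (q ^ e * kappa) ^ s * q ^ 'C(s, 2)) _ _) _.
  + move=> y /setIdP[/XP[d1 d2 yGS yGG _] /eqP yS].
    by rewrite !inE yGS yS yGG capvSr d2 !eqxx.
  + move=> E; rewrite inE => /andP[_]; rewrite inE => /andP[EG /eqP dE].
    apply: leq_trans (card_gen_cap PA rank_le dim_ambient center_gen EG dE).
    apply: subset_leq_card; apply/subsetP => y.
    case/setIdP=> /setIdP[/setIdP[Yy _] _] yE.
    by rewrite inE Y_gen.
  rewrite leq_mul2r; apply/orP; right.
  apply: leq_trans (subset_leq_card (subsetIl _ _)) _.
  (* [E] is a relative complement of [S] in [G] over [K]; the codimensions [3s] of [S] in [G] and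
     [s] of [K] in [S] give the exponent [3 * s ^ 2]. *)
  apply: leq_trans (card_relative_complements _ _ _) _.
  rewrite leq_exp2l ?finNzRing_gt1 // dG.
  have -> : (d - \dim S = 3 * s)%N by move: dS'; dimlia.
  have -> : (\dim S - \dim K = s)%N by move: dS' dK; dimlia.
  by rewrite -mulnA mulnn.
rewrite [leqRHS]mulnA [leqRHS]mulnC [(_ * q ^ (3 * _))%N]mulnC.
rewrite leq_mul2r; apply/orP; right; apply: leq_trans (card_bigcup_le _ _) _.
rewrite big_geq_mkord; apply: leq_sum => i i0.
apply: leq_trans (card_codim_cap_le LS (leq_subr i s)) _.
have -> : \dim L = (d - 4 * s + 1)%N by rewrite dL addn1.
have -> : (s - (s - i) = i)%N by apply: subKn; apply: ltnW.
have -> : (\dim S - (d - 4 * s + 1) = s - 1)%N by move: dS' ds; dimlia.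
by rewrite [leqLHS]mulnC mulnA.
Qed.

End Far.

Lemma EKR_center B1 :
  Y != set0 ->
  (forall S, tsing S -> (\dim S + 3 * s = d)%N ->
    (#|[set y in Y | d - 4 * s < \dim (y :&: S)]| <= B1)%N) ->
  (B1 + (q ^ e * kappa) ^ s * q ^ 'C(s, 2) *
   (q ^ (3 * s ^ 2) * \sum_(1 <= i < s)
     q ^ ((s - 1 - i) * (s - i)) * qbin q (d - 4 * s + 1) (s - i)
       * qbin q (s - 1) i) < #|Y|)%N ->
  exists2 G, gen G & {in Y, forall y, (d <= \dim (y :&: G) + s)%N}.
Proof.
move=> /set0Pn[y Yy] nearP ltY.
pose cond (p : {vspace V} * {vspace V} * {vspace V}) :=
  [&& p.1.1 \in Y, p.1.2 \in Y & p.2 \in Y].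
pose tri (p : {vspace V} * {vspace V} * {vspace V}) : nat :=
  \dim (p.1.1 :&: p.1.2 :&: p.2).
have c0 : cond (y, y, y) by rewrite /cond /= Yy.
(* The triple is chosen with an intersection of least dimension, repetitions allowed. *)
case: (arg_minnP tri c0) => -[[y1 y2] y3] /and3P[/= Y1 Y2 Y3] minP.
have tri_le z1 z2 z3 : z1 \in Y -> z2 \in Y -> z3 \in Y ->
    (\dim (y1 :&: y2 :&: y3) <= \dim (z1 :&: z2 :&: z3))%N.
  by move=> Z1 Z2 Z3; apply: (minP (z1, z2, z3)); rewrite /cond /= Z1 Z2.
have tS : tsing (y1 :&: y2 :&: y3).
  by have [t3 _] := genP _ _ _ _ (Y_gen Y3); apply: tsingS t3; exact: capvSr.
have dS := EKR_triple Y1 Y2 Y3.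
have [dSE|dSlt] := eqVneq (\dim (y1 :&: y2 :&: y3) + 3 * s)%N d.
  pose G := (y1 :&: y2 + y1 :&: y3 + y2 :&: y3)%VS.
  exists G; first exact: center_gen.
  move=> y0 Yy0; rewrite leqNgt; apply/negP => far.
  have le1 := nearP _ tS dSE.
  have le2 := far_card Y1 Y2 Y3 dSE Yy0 far.
  move: ltY; rewrite ltnNge => /negP; apply.
  apply: leq_trans _ (leq_add le1 le2).
  rewrite -(cardsID [set z | d - 4 * s < \dim (z :&: (y1 :&: y2 :&: y3))]%N Y).
  apply: leq_add; apply: subset_leq_card; apply/subsetP => z; rewrite !inE.
    by [].
  by rewrite -leqNgt andbC.
have [S0 /andP[_ S0S] dS0] : exists2 S0,
    (0 <= S0 <= y1 :&: y2 :&: y3)%VS & \dim S0 = (d - 3 * s)%N.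
  by apply: subv_dim_between; rewrite ?sub0v // dimv0; move: dS; dimlia.
have := nearP S0 (tsingS S0S tS); rewrite dS0 => /(_ ltac:(move: ds; clear; lia)).
suff -> : [set y in Y | d - 4 * s < \dim (y :&: S0)]%N = Y.
  by move: ltY; clear; lia.
apply/setP => z; rewrite inE; case: (boolP (z \in Y)) => //= Yz.
(* Let [S] be the triple intersection. By minimality [u :&: v :&: z] is at least as large as [S];
   both lie in [u :&: v] and meet in [z :&: S]. Summed over the three pairs and combined with
   [gen_triple], this yields [3 * \dim (z :&: S) >= 4 * \dim S - d]. As [\dim S > d - 3s], passing
   to [S0] leaves [\dim (z :&: S0) > d - 4s]. *)
have sum2 u v w : u \in Y -> v \in Y -> w \in Y -> (y1 :&: y2 :&: y3 = u :&: v :&: w)%VS ->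
   (2 * \dim (y1 :&: y2 :&: y3) <=
    \dim (u :&: v) + \dim (z :&: (y1 :&: y2 :&: y3)))%N.
  move=> Yu Yv Yw SE.
  have sub : (u :&: v :&: z + y1 :&: y2 :&: y3 <= u :&: v)%VS.
    by rewrite subv_add capvSl SE capvSl.
  have cE : (u :&: v :&: z :&: (y1 :&: y2 :&: y3) = z :&: (y1 :&: y2 :&: y3))%VS.
    rewrite SE; apply/vspaceP => x; rewrite !memv_cap.
    by do 4!case: (x \in _).
  have := dimv_sum_cap (u :&: v :&: z) (y1 :&: y2 :&: y3); rewrite cE.
  by move: (dimvS sub) (tri_le u v z Yu Yv Yz); dimlia.
have s12 := sum2 _ _ _ Y1 Y2 Y3 erefl.
have s13 := sum2 y1 y3 y2 Y1 Y3 Y2 ltac:(by rewrite -!capvA (capvC y2)).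
have s23 := sum2 y2 y3 y1 Y2 Y3 Y1 ltac:(by rewrite -capvA capvC).
have tri3 := gen_triple PA rank_le (Y_gen Y1) (Y_gen Y2) (Y_gen Y3).
have sub0 : (z :&: (y1 :&: y2 :&: y3) + S0 <= y1 :&: y2 :&: y3)%VS.
  by rewrite subv_add capvSr.
have cE : (z :&: (y1 :&: y2 :&: y3) :&: S0 = z :&: S0)%VS.
  by rewrite -capvA (capv_idPr S0S).
have := dimv_sum_cap (z :&: (y1 :&: y2 :&: y3)) S0; rewrite cE dS0.
move: s12 s13 s23 tri3 (dimvS sub0) dS dSlt ds; dimlia.
Qed.

End EKR.

(** * Quadratic, alternating and Hermitian forms *)

Section Conjugation.
Variable F : finFieldType.
Hypothesis square_card : #|F| = (Nat.sqrt #|F| ^ 2)%N.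

Lemma conjFK : involutive (@conjF F).
Proof.
by move=> x; rewrite /conjF -exprM mulnn -square_card expf_card.
Qed.

(** The square root of the field order is a power of the characteristic, so the map is additive.
    Bundling it gives access to the lemmas on forms twisted by a ring morphism. *)
Lemma conjF_rmorphism : {phi : {rmorphism F -> F} | (phi : F -> F) = @conjF F}.
Proof.
have D : {morph @conjF F : x y / x + y}.
  move=> x y; rewrite /conjF exprDn_pchar //.
  have [p p_pr charFp] := finPcharP F.
  have : [pchar F].-nat (Nat.sqrt #|F| ^ 2)%N.
    rewrite -square_card (card_pprimeChar charFp) pnatX.
    by rewrite (pnatE _ p_pr) charFp.
  by rewrite pnatX orbF.
have s0 : (0 < Nat.sqrt #|F|)%N.
  rewrite lt0n; apply/eqP => s0; have := finNzRing_gt1 F.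
  by rewrite square_card s0.
have nm : nmod_morphism (@conjF F).
  by split=> //; rewrite /conjF expr0n; case: (Nat.sqrt _) s0.
have mm : monoid_morphism (@conjF F).
  by split=> [|x y]; rewrite /conjF ?expr1n ?exprMn.
pose aM := GRing.isNmodMorphism.Build F F (@conjF F) nm.
pose mM := GRing.isMonoidMorphism.Build F F (@conjF F) mm.
pose phi : {rmorphism F -> F} := HB.pack (@conjF F) aM mM.
by exists phi.
Qed.

End Conjugation.

Section FormOfMatrix.
Variables (F : finFieldType) (m : nat) (phi : {rmorphism F -> F}).
Variable A : 'M[F]_m.
Implicit Types u v w : 'rV[F]_m.
Local Notation fm := (form_of_matrix phi A).

Lemma form_of_matrixPl a u w v : fm (a *: u + w) v = a * fm u v + fm w v.
Proof.
by rewrite /form_of_matrix !mulmxDl -!scalemxAl linearD /= linearZ.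
Qed.

Lemma form_of_matrixPr u a v w : fm u (a *: v + w) = phi a * fm u v + fm u w.
Proof.
rewrite /form_of_matrix linearD linearZ /= map_mxD map_mxZ mulmxDr -scalemxAr.
by rewrite linearD /= linearZ.
Qed.

Lemma form_of_matrix_mul n (M : 'M[F]_(n, m)) (u v : 'rV[F]_n) :
  form_of_matrix phi (M *m A *m map_mx phi M^T) u v = fm (u *m M) (v *m M).
Proof.
by rewrite /form_of_matrix trmx_mul map_mxM !mulmxA.
Qed.

Lemma form_of_matrix_tr u v :
  map_mx phi A^T = A -> involutive phi -> fm u v = phi (fm v u).
Proof.
move=> AE phiK; rewrite /form_of_matrix -trace_map_mx -[RHS]mxtrace_tr.
have uE : map_mx phi (map_mx phi u^T) = u^T.
  by apply/matrixP => i j; rewrite !mxE phiK.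
by rewrite !map_mxM /= uE !trmx_mul trmxK !map_trmx AE mulmxA.
Qed.

End FormOfMatrix.

Section Kinds.
Variables (F : finFieldType) (m : nat).
Local Notation V := 'rV[F]_m.
Local Notation q := #|F|.
Implicit Types (K : form_kind) (A : 'M[F]_m).

Definition kind_theta K : F -> F :=
  if K is HermitianForm then @conjF F else idfun.

(** Orthogonality on a quadric is that of the polar form; [kind_sing] keeps the quadratic form
    itself, which the polar form does not determine in characteristic 2. *)
Definition kind_form K A (u v : V) : F :=
  if K is QuadraticForm then polar_form A u v
  else form_of_matrix (kind_theta K) A u v.

Definition kind_sing K A (v : V) : bool :=
  match K with
  | QuadraticForm => qform A v == 0
  | AlternatingForm => true
  | HermitianForm => form_of_matrix (@conjF F) A v v == 0
  end.

Definition kind_kappa K : nat :=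
  match K with
  | QuadraticForm => 1
  | AlternatingForm => q
  | HermitianForm => Nat.sqrt q
  end.

Lemma form_of_matrixDl (phi : {rmorphism F -> F}) A (u v w : V) :
  form_of_matrix phi A (u + v) w = form_of_matrix phi A u w + form_of_matrix phi A v w.
Proof. by have := form_of_matrixPl phi A 1 u v w; rewrite scale1r mul1r. Qed.

Lemma form_of_matrixDr (phi : {rmorphism F -> F}) A (u v w : V) :
  form_of_matrix phi A w (u + v) = form_of_matrix phi A w u + form_of_matrix phi A w v.
Proof. by have := form_of_matrixPr phi A w 1 u v; rewrite scale1r rmorph1 mul1r. Qed.

Lemma form_of_matrixZl (phi : {rmorphism F -> F}) A a (u v : V) :
  form_of_matrix phi A (a *: u) v = a * form_of_matrix phi A u v.
Proof. by rewrite /form_of_matrix -!scalemxAl linearZ. Qed.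

Lemma form_of_matrixZr (phi : {rmorphism F -> F}) A a (u v : V) :
  form_of_matrix phi A u (a *: v) = phi a * form_of_matrix phi A u v.
Proof. by rewrite /form_of_matrix linearZ map_mxZ -scalemxAr linearZ. Qed.

Lemma polar_formE A (u v : V) :
  polar_form A u v = form_of_matrix idfun A u v + form_of_matrix idfun A v u.
Proof.
by rewrite /polar_form /qform form_of_matrixDl !form_of_matrixDr; ring.
Qed.

Lemma qformP A a (u v : V) :
  qform A (a *: u + v) = a ^+ 2 * qform A u + qform A v + a * polar_form A u v.
Proof.
rewrite polar_formE /qform form_of_matrixDl !form_of_matrixDr.
by rewrite !(form_of_matrixZl, form_of_matrixZr) /=; ring.
Qed.

(** On the line [v + a *: e] with [e] singular the quadratic form is affine in [a] with nonzero
    slope, which gives [kappa = 1]. *)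
Lemma quadratic_axioms A : nondegenerate_form QuadraticForm A ->
  polar_axioms (kind_theta QuadraticForm) (kind_form QuadraticForm A)
    (kind_sing QuadraticForm A) (kind_kappa QuadraticForm).
Proof.
move=> /forallP nd; split; rewrite /kind_form /kind_theta /kind_sing.
- move=> v a u w; rewrite !polar_formE form_of_matrixPl form_of_matrixPr /=; ring.
- move=> v a u w; rewrite !polar_formE form_of_matrixPl form_of_matrixPr /=; ring.
- by [].
- by move=> c; exists c.
- by move=> u v; rewrite !polar_formE addrC.
- by rewrite /qform -[0 in X in form_of_matrix _ _ X](scale0r 0) form_of_matrixZl mul0r.
- move=> a u v /eqP qu /eqP qv buv; rewrite qformP qu qv buv.
  by rewrite !mulr0 !addr0.
- move=> v qv bv; apply/eqP; have /implyP := nd v; apply; rewrite qv.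
  by apply/forallP => u; rewrite bv.
move=> e v /eqP qe bve.
apply: leq_trans (_ : #|[set - qform A v / polar_form A v e]| <= _)%N;
  last by rewrite cards1.
apply: subset_leq_card; apply/subsetP => a; rewrite !inE addrC qformP qe.
have -> : polar_form A e v = polar_form A v e by rewrite !polar_formE addrC.
by rewrite mulr0 add0r addrC addr_eq0 => /eqP <-; rewrite mulfK.
Qed.

Lemma alternating_axioms A : nondegenerate_form AlternatingForm A ->
  polar_axioms (kind_theta AlternatingForm) (kind_form AlternatingForm A)
    (kind_sing AlternatingForm A) (kind_kappa AlternatingForm).
Proof.
move=> /andP[/forallP alt /forallP nd].
have anti (u v : V) : form_of_matrix idfun A u v = - form_of_matrix idfun A v u.
  have /eqP := alt (u + v); rewrite form_of_matrixDl !form_of_matrixDr.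
  rewrite (eqP (alt u)) (eqP (alt v)) add0r addr0 => /eqP.
  by rewrite addr_eq0 => /eqP.
split; rewrite /kind_form /kind_theta /kind_sing //.
- by move=> v a u w; rewrite form_of_matrixPl.
- by move=> v a u w; rewrite form_of_matrixPr.
- by move=> c; exists c.
- by move=> u v buv; rewrite anti buv oppr0.
- move=> v _ bv; apply/eqP; have /implyP := nd v; apply.
  by apply/forallP => u; rewrite bv.
by move=> e v _ _; apply: max_card.
Qed.

Lemma hermitian_axioms A : nondegenerate_form HermitianForm A ->
  polar_axioms (kind_theta HermitianForm) (kind_form HermitianForm A)
    (kind_sing HermitianForm A) (kind_kappa HermitianForm).
Proof.
move=> /and3P[/eqP sq /is_hermitianmxP AE /forallP nd].
have cK := conjFK sq; have [phi phiE] := conjF_rmorphism sq.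
rewrite /kind_form /kind_theta /kind_sing.
rewrite expr0 scale1r in AE; rewrite -phiE in AE nd cK *.
have her (u v : V) := form_of_matrix_tr u v (esym AE) cK.
split.
- by move=> v a u w; rewrite form_of_matrixPl.
- by move=> v a u w; rewrite form_of_matrixPr.
- exact: rmorph0.
- by move=> c; exists (phi c); rewrite cK.
- by move=> u v buv; rewrite her buv rmorph0.
- by rewrite -[0 in X in form_of_matrix _ _ X](scale0r 0) form_of_matrixZl mul0r.
- move=> a u v /eqP su /eqP sv buv; rewrite form_of_matrixDl !form_of_matrixDr.
  have bvu : form_of_matrix phi A v u = 0 by rewrite her buv rmorph0.
  rewrite !(form_of_matrixZl, form_of_matrixZr) su sv buv bvu.
  by rewrite !mulr0 !addr0.
- move=> v _ bv; apply/eqP; have /implyP := nd v; apply.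
  by apply/forallP => u; rewrite bv.
move=> e v /eqP se bve; rewrite /kind_kappa; set r := Nat.sqrt q.
set c := form_of_matrix phi A v e in bve.
have r1 : (1 < r)%N.
  have := finNzRing_gt1 F; rewrite sq -/r.
  by case: (r) => [|[|?]].
(* The value of the form at [v + a *: e] is that of [p] at [a]; its leading coefficient [c] is
   nonzero, so there are at most [r] roots. *)
pose p : {poly F} :=
  c *: 'X^r + phi c *: 'X + (form_of_matrix phi A v v)%:P.
have pr : p`_r = c.
  rewrite !coefE eqxx mulr1 gtn_eqF // mulr0.
  by rewrite (gtn_eqF (ltnW r1)) !addr0.
have p0 : p != 0 by apply: contra_neq bve => p0; rewrite -pr p0 coef0.
have sp : (size p <= r.+1)%N.
  apply/leq_sizeP => j rj; rewrite !coefE gtn_eqF // mulr0.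
  by rewrite !gtn_eqF ?mulr0 ?addr0 //; lia.
rewrite -ltnS; apply: leq_trans sp; rewrite cardE; apply: max_poly_roots => //.
  apply/allP => a; rewrite mem_enum inE form_of_matrixDl !form_of_matrixDr.
  rewrite !(form_of_matrixZl, form_of_matrixZr) se -/c => /eqP eq0.
  rewrite /root !hornerE; apply/eqP; rewrite -[RHS]eq0 (her e v) -/c.
  have -> : phi a = a ^+ r by rewrite phiE.
  by ring.
exact: enum_uniq.
Qed.

Lemma kind_axioms K A : nondegenerate_form K A ->
  polar_axioms (kind_theta K) (kind_form K A) (kind_sing K A) (kind_kappa K).
Proof.
case: K; [exact: quadratic_axioms | exact: alternating_axioms |].
exact: hermitian_axioms.
Qed.

Lemma totally_singularE K A (U : {vspace V}) :
  totally_singular K A U = tsing (kind_form K A) (kind_sing K A) U.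
Proof.
have in2P (f : V -> V -> F) :
    reflect {in U &, forall u v, f u v = 0}
      [forall u : V in U, forall v : V in U, f u v == 0].
  apply: (iffP forallP) => [h u v uU vU|h u].
    by have /implyP/(_ uU)/forallP/(_ v)/implyP/(_ vU)/eqP := h u.
  by apply/implyP => uU; apply/forallP => v; apply/implyP => vU; rewrite h.
apply/idP/tsingP; case: K => /=.
- move=> /forallP h; have hU u : u \in U -> qform A u = 0.
    by move=> uU; apply/eqP; exact: (implyP (h u)).
  split=> [u /hU/eqP //|u v uU vU].
  by rewrite /kind_form /polar_form !hU ?subr0 // memvD.
- by move/in2P.
- by move/in2P=> h; split=> // u uU; rewrite /kind_sing h.
- by case=> h _; apply/forallP => u; apply/implyP => uU; exact: h.
- by case=> _ h; apply/in2P.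
- by case=> _ h; apply/in2P.
Qed.

End Kinds.

(** * Quotient polar spaces *)

(** The excess [ambient_dim T 0] is the parameter [e] of the generator counts. *)
Lemma ambient_dimE T d : ambient_dim T d = (2 * d + ambient_dim T 0)%N.
Proof. by case: T => /=; lia. Qed.

Section PolarRank.
Variables (F : finFieldType) (m : nat) (K : form_kind) (A : 'M[F]_m).
Local Notation V := 'rV[F]_m.
Local Notation ts := (tsing (kind_form K A) (kind_sing K A)).
Hypothesis nd : nondegenerate_form K A.

Lemma tsing0 : ts 0%VS.
Proof.
have PA := kind_axioms nd; apply/tsingP; split=> [u|u v]; rewrite memv0 => /eqP->.
  exact: pa_sing0 PA.
by move=> _; exact: (pform0l PA).
Qed.

Lemma polar_rankP d : polar_rank K A = d <->
  (forall U : {vspace V}, ts U -> (\dim U <= d)%N) /\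
  (exists2 U : {vspace V}, ts U & \dim U = d).
Proof.
rewrite /polar_rank; split=> [<-|[le [U0 tU0 dU0]]].
  split=> [U tU|].
    by apply: leq_bigmax_cond; rewrite totally_singularE.
  have ts0 : totally_singular K A 0%VS by rewrite totally_singularE tsing0.
  rewrite (bigop.bigmax_eq_arg 0%VS ts0); case: arg_maxnP => // U tU _.
  by exists U => //; rewrite -totally_singularE.
apply/eqP; rewrite eqn_leq; apply/andP; split.
  by apply/bigop.bigmax_leqP => U; rewrite totally_singularE; exact: le.
by rewrite -dU0; apply: leq_bigmax_cond; rewrite totally_singularE.
Qed.

Lemma generatorE d (U : {vspace V}) : polar_rank K A = d ->
  generator K A U = gen (kind_form K A) (kind_sing K A) d U.
Proof.
move=> /polar_rankP[rle rex].
rewrite (gen_maximal (kind_axioms nd) rle rex) /generator totally_singularE.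
congr andb; apply: eq_forallb => W; by rewrite totally_singularE.
Qed.

End PolarRank.

(** * Forms induced on a subspace, in coordinates *)

Section Pullback.
Variables (F : finFieldType) (m n : nat) (K : form_kind) (A : 'M[F]_m).
Variable M : 'M[F]_(n, m).
Hypothesis nd : nondegenerate_form K A.

Definition pullback : 'M[F]_n := M *m A *m map_mx (@kind_theta F K) M^T.

Lemma form_pullback (u v : 'rV[F]_n) :
  form_of_matrix (@kind_theta F K) pullback u v
  = form_of_matrix (@kind_theta F K) A (u *m M) (v *m M).
Proof.
rewrite /pullback; case: K nd => [_|_|/and3P[/eqP sq _ _]] /=.
- exact: (form_of_matrix_mul idfun).
- exact: (form_of_matrix_mul idfun).
by have [phi <-] := conjF_rmorphism sq; exact: form_of_matrix_mul.
Qed.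

Lemma kind_form_pullback (u v : 'rV[F]_n) :
  kind_form K pullback u v = kind_form K A (u *m M) (v *m M).
Proof.
have := form_pullback; rewrite /pullback /kind_form.
case: K => /= fp; rewrite ?fp //.
by rewrite /polar_form /qform !fp mulmxDl.
Qed.

Lemma kind_sing_pullback (v : 'rV[F]_n) :
  kind_sing K pullback v = kind_sing K A (v *m M).
Proof.
have := form_pullback; rewrite /pullback /kind_sing /qform.
by case: K => /= fp; rewrite ?fp.
Qed.

Lemma nondegenerate_pullback :
  (forall v : 'rV[F]_n, kind_sing K A (v *m M) ->
     (forall u, kind_form K A (u *m M) (v *m M) = 0) -> v = 0) ->
  nondegenerate_form K pullback.
Proof.
move=> ndM.
have ndP (v : 'rV[F]_n) : kind_sing K pullback v ->
    (forall u, kind_form K pullback u v = 0) -> v = 0.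
  move=> sv bv; apply: ndM; first by rewrite -kind_sing_pullback.
  by move=> u; rewrite -kind_form_pullback.
move: ndP form_pullback; rewrite /pullback; case: K nd => /= ndA ndP fp.
- apply/forallP => v; apply/implyP => /andP[sv /forallP bv].
  by apply/eqP; apply: ndP => // u; exact/eqP.
- have [/forallP alt _] := andP ndA; apply/andP; split.
    by apply/forallP => v; rewrite fp alt.
  apply/forallP => v; apply/implyP => /forallP bv.
  by apply/eqP; apply: ndP => // u; exact/eqP.
have [/eqP sq /is_hermitianmxP AE _] := and3P ndA.
apply/and3P; split; first exact/eqP.
  apply/is_hermitianmxP; rewrite expr0 scale1r in AE *.
  have cK := conjFK sq; have [phi phiE] := conjF_rmorphism sq.
  rewrite -phiE in AE cK *.
  have ME : map_mx phi (map_mx phi M^T)^T = M.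
    by apply/matrixP => i j; rewrite !mxE cK.
  by rewrite !trmx_mul !map_mxM -AE ME mulmxA scale1r.
apply/forallP => v; apply/implyP => /forallP bv.
apply/eqP; apply: ndP => [|u]; last exact/eqP.
by have := bv v.
Qed.

End Pullback.

(** The rows of [M] are a basis of [C]. Keeping [n] apart from [\dim C] allows coordinates in
    dimension [ambient_dim T n]. *)
Lemma subspace_matrix (F : finFieldType) (m n : nat)
    (C : {vspace 'rV[F]_m}) : n = \dim C ->
  exists M : 'M[F]_(n, m), (forall u : 'rV[F]_n, u *m M = 0 -> u = 0) /\
    (forall v, v \in C <-> exists u : 'rV[F]_n, v = u *m M).
Proof.
move=> ->; exists (\matrix_i (vbasis C)`_i).
have mulE (u : 'rV[F]_(\dim C)) :
    u *m (\matrix_i (vbasis C)`_i) = \sum_i u 0 i *: (vbasis C)`_i.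
  by rewrite mulmx_sum_row; apply: eq_bigr => i _; rewrite rowK.
split=> [u|v].
  rewrite mulE => u0; have /freeP fr := basis_free (vbasisP C).
  by apply/rowP => i; rewrite (fr _ u0) mxE.
split=> [vC|[u ->]].
  exists (\row_i coord (vbasis C) i v).
  by rewrite mulE {1}(coord_vbasis vC); apply: eq_bigr => i _; rewrite mxE.
rewrite mulE; apply: memv_suml => i _; apply: memvZ.
by rewrite (basis_mem (vbasisP C)) // mem_nth ?size_tuple.
Qed.

(* Generators through a totally singular subspace P correspond to generators of
   the polar space induced on a complement C of P in its perp, which realizes
   the quotient of the perp by P. *)
Lemma card_EKR_through (F : finFieldType) (T : polar_family) (d n t : nat)
    (A : 'M[F]_(ambient_dim T d))
    (P : {vspace 'rV[F]_(ambient_dim T d)})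
    (Y : {set {vspace 'rV[F]_(ambient_dim T d)}}) :
  is_polar_space A -> is_EKR A t Y ->
  tsing (kind_form (kind_of T) A) (kind_sing (kind_of T) A) P ->
  (\dim P + n = d)%N ->
  (#|[set y in Y | P <= y]%VS| <= EKR_max F T n t)%N.
Proof.
move=> /andP[nd /eqP rk] /andP[/forallP Ygen /forallP YEKR] tP dP.
set X := [set y in Y | _]; have [->|[y0 y0X]] := set_0Vmem X; first by rewrite cards0.
have PA := kind_axioms nd; have [rle rex] := (polar_rankP nd d).1 rk.
set b := kind_form (kind_of T) A in PA tP rle rex.
set sg := kind_sing (kind_of T) A in PA tP rle rex.
have XP y : y \in X -> [/\ y \in Y, gen b sg d y, (P <= y)%VS & (y <= perp b P)%VS].
  case/setIdP=> yY Py; have /implyP/(_ yY) := Ygen y.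
  rewrite /is_generator (generatorE nd _ rk) => gy; split=> //.
  have [/tsingP[_ by0] _] := genP _ _ _ _ gy.
  apply/subvP => v vy; apply/(perpP PA) => u uP; apply: by0 => //.
  exact: (subvP Py).
set C := (perp b P :\: P)%VS.
have PP : (P <= perp b P)%VS.
  by have [_ _ Py yP] := XP _ y0X; exact: subv_trans yP.
have CP : (C :&: P = 0)%VS by exact: capv_diff.
have CPE : (P + C = perp b P)%VS.
  by rewrite addvC /C addv_diff; apply/addv_idPl.
(* The perp of [P] loses [\dim P] dimensions and the quotient as many again, so the family stays the
   same while the rank drops from [d] to [n]. *)
have dC : ambient_dim T n = \dim C.
  have := dim_perp PA tP; have := dimv_sum_cap P C.
  rewrite CPE capvC CP dimv0 addn0.
  by move: dP (ambient_dimE T n) (ambient_dimE T d); dimlia.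
have [M [Minj MC]] := subspace_matrix dC.
pose phi : 'Hom('rV[F]_(ambient_dim T n), 'rV[F]_(ambient_dim T d)) :=
  linfun (mulmxr M).
have phiE u : phi u = u *m M by rewrite lfunE.
have kphi : lker phi == 0%VS.
  rewrite -subv0; apply/subvP => u; rewrite memv_ker phiE memv0 => /eqP.
  by move/Minj=> ->.
have limphi : limg phi = C.
  apply/vspaceP => v; apply/memv_imgP/idP => [[u _ ->]|/MC[u ->]].
    by rewrite phiE; apply/MC; exists u.
  by exists u; rewrite ?memvf.
pose rho (W : {vspace 'rV[F]_(ambient_dim T d)}) := (phi @^-1: W)%VS.
have phirho W : (phi @: rho W = W :&: C)%VS.
  by rewrite /rho -lpreim_cap_limg limphi lpreimK // limphi capvSr.
have dphi U : \dim (phi @: U)%VS = \dim U.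
  by apply: limg_dim_eq; rewrite (eqP kphi) capv0.
have rhoP W : (P <= W)%VS -> (W <= perp b P)%VS ->
    (P + phi @: rho W)%VS = W /\ (\dim P + \dim (rho W) = \dim W)%N.
  move=> PW WP; have E : (P + phi @: rho W)%VS = W.
    by rewrite phirho capvC vspace_modl // CPE; apply/capv_idPr.
  split=> //; have := dimv_sum_cap P (phi @: rho W)%VS; rewrite E dphi.
  suff -> : (P :&: phi @: rho W)%VS = 0%VS by rewrite dimv0 addn0.
  apply/eqP; rewrite -subv0 -CP phirho subv_cap capvSl andbT.
  by rewrite (subv_trans (capvSr _ _)) ?capvSr.
pose A' := pullback (kind_of T) A M.
(* A singular vector of [C] orthogonal to [C] is orthogonal to the whole perp of [P]. Outside [P] it
   would enlarge [P] to a totally singular subspace with no smaller perp, against [dim_perp]; so it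
   lies in [C :&: P = 0]. *)
have nd' : nondegenerate_form (kind_of T) A'.
  apply: nondegenerate_pullback => // v sv bv.
  have vC : v *m M \in C by apply/MC; exists v.
  have vPP : v *m M \in perp b P by rewrite -CPE (subvP (addvSr _ _)).
  suff vP : v *m M \in P.
    by apply: Minj; apply/eqP; rewrite -memv0 -CP memv_cap vC.
  apply: contraT => vnP.
  have bvP u : u \in perp b P -> b u (v *m M) = 0.
    rewrite -CPE => /memv_addP[u1 u1P [u2 /MC[w ->] ->]].
    rewrite (pformDl PA) [X in _ + X]bv addr0; apply: (pa_refl PA).
    exact: (perpP PA _ _ vPP).
  have tv : tsing b sg (P + <[v *m M]>).
    apply: (tsingD PA) => //; first by apply: (tsing_line PA); rewrite ?bvP.
    move=> u _ uP /vlineP[k ->]; rewrite (pformZr PA) bvP ?mulr0 //.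
    exact: (subvP PP).
  have sub : (perp b P <= perp b (P + <[v *m M]>))%VS.
    apply/subvP => u uPP; apply/(perpP PA) => _ /memv_addP[u1 u1P [_ /vlineP[k ->] ->]].
    by rewrite (pformDr PA) (perpP PA _ _ uPP) // (pformZr PA) bvP ?mulr0 ?addr0.
  have := dim_perp PA tv; have := dim_perp PA tP; have := dimvS sub.
  by rewrite dimv_add_line //; dimlia.
have PA' := kind_axioms nd'.
have tsE U : tsing (kind_form (kind_of T) A') (kind_sing (kind_of T) A') U
    = tsing b sg (phi @: U).
  apply/tsingP/tsingP => -[h1 h2]; split.
  - move=> _ /memv_imgP[u uU ->]; rewrite phiE /sg -kind_sing_pullback //.
    exact: h1.
  - move=> _ _ /memv_imgP[u uU ->] /memv_imgP[v vU ->].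
    by rewrite !phiE /b -kind_form_pullback //; exact: h2.
  - move=> u uU; rewrite kind_sing_pullback // -phiE; apply: h1.
    exact: memv_img.
  - move=> u v uU vU; rewrite kind_form_pullback // -!phiE.
    by apply: h2; exact: memv_img.
(* Adding [P] to the image of a totally singular subspace gives the upper bound; the member [y0]
   through [P] attains it. *)
have rk' : polar_rank (kind_of T) A' = n.
  apply/(polar_rankP nd'); split.
    move=> U; rewrite tsE => tU.
    have UC : (phi @: U <= C)%VS by rewrite -limphi limgS ?subvf.
    have tPU : tsing b sg (P + phi @: U).
      apply: (tsingD PA) => // u v uP vU; apply: (pa_refl PA).
      have /(perpP PA) : v \in perp b P.
        by rewrite -CPE (subvP (addvSr _ _)) // (subvP UC).
      exact.
    have := rle _ tPU; have := dimv_sum_cap P (phi @: U)%VS; rewrite dphi.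
    have -> : (P :&: phi @: U)%VS = 0%VS.
      by apply/eqP; rewrite -subv0 -CP subv_cap capvSl (subv_trans (capvSr _ _)).
    by rewrite dimv0; move: dP; dimlia.
  have [_ /genP[ty0 dy0] Py0 y0P] := XP _ y0X; exists (rho y0).
    by rewrite tsE phirho; apply: tsingS ty0; exact: capvSl.
  by have [_] := rhoP _ Py0 y0P; move: dy0 dP; dimlia.
have injrho : {in X &, injective rho}.
  move=> y z yX zX yz; have [_ _ Py yP] := XP _ yX; have [_ _ Pz zP] := XP _ zX.
  have [Ey _] := rhoP _ Py yP; have [Ez _] := rhoP _ Pz zP.
  by rewrite -Ey -Ez yz.
rewrite -(card_in_imset injrho).
have polA' : is_polar_space A' by rewrite /is_polar_space nd' rk' eqxx.
suff EKR' : is_EKR A' t (rho @: X).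
  apply: leq_trans (leq_bigmax_cond A' polA').
  exact: (leq_bigmax_cond (F := fun Z : {set _} => #|Z|)).
apply/andP; split.
  apply/forallP => y'; apply/implyP => /imsetP[y yX ->].
  rewrite /is_generator (generatorE nd' _ rk').
  have [_ /genP[ty dy] Py yP] := XP _ yX; apply/genP; split.
    by rewrite tsE phirho; apply: tsingS ty; exact: capvSl.
  by have [_] := rhoP _ Py yP; move: dy dP; dimlia.
apply/forallP => y'; apply/implyP => /imsetP[y yX ->].
apply/forallP => z'; apply/implyP => /imsetP[z zX ->].
have [yY _ Py yP] := XP _ yX; have [zY _ Pz zP] := XP _ zX.
have -> : (rho y :&: rho z)%VS = rho (y :&: z)%VS.
  by apply/vspaceP => u; rewrite memv_cap -!memv_preim memv_cap.
have Pyz : (P <= y :&: z)%VS by rewrite subv_cap Py.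
have [_ dyz] := rhoP _ Pyz (subv_trans (capvSl _ _) yP).
have /implyP/(_ yY)/forallP/(_ z)/implyP/(_ zY) := YEKR y.
by move: dyz dP; dimlia.
Qed.

(** * Gaussian coefficients and the bounds *)

Lemma qbin_small q n k : (n < k)%N -> qbin q n k = 0%N.
Proof.
elim: n k => [|n IHn] [|k] //= nk.
by rewrite !IHn ?muln0 // ltnW.
Qed.

Section Bounds.
Variable R : rcfType.

(** The product formula without division. The recursion reduces it to [q^(n+1) - 1 = (q^(n-k) - 1) +
    q^(n-k) (q^(k+1) - 1)]. *)
Lemma qbin_prod (q n k : nat) :
  (qbin q n k)%:R * \prod_(i < k) (q%:R ^+ i.+1 - 1)
  = \prod_(i < k) (q%:R ^+ (n - i) - 1) :> R.
Proof.
elim: n k => [|n IHn] [|k].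
- by rewrite !big_ord0 mulr1.
- by rewrite mul0r big_ord_recl expr0 subrr mul0r.
- by rewrite !big_ord0 mulr1.
rewrite [in RHS]big_ord_recl /= natrD mulrDl IHn big_ord_recr /= natrM.
rewrite [\prod_(i < k.+1) _]big_ord_recr /= natrX.
under [in RHS]eq_bigr => i _ do rewrite /bump /= subSS.
(* For [n < k] the subtraction [n - k] is truncated, but then all terms vanish. *)
rewrite subn0; have [kn|nk] := leqP k n; last first.
  by rewrite -IHn qbin_small // !mul0r !mulr0 !mul0r addr0.
have -> : q%:R ^+ n.+1 = q%:R ^+ (n - k) * q%:R ^+ k.+1 :> R.
  by rewrite -exprD addnS subnK.
by rewrite -IHn; ring.
Qed.

Lemma gauss_qbin (q n k : nat) : (1 < q)%N ->
  gauss (q%:R : R) n%:Z k%:Z = (qbin q n k)%:R.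
Proof.
move=> q1; rewrite /gauss; case: ifP => [/andP[_ kn]|/negbT kn]; last first.
  by have /qbin_small-> : (n < k)%N by lia.
rewrite absz_nat big_add1 /= big_mkord prodf_div.
have -> : \prod_(i < k) (q%:R ^ (n%:Z - i.+1%:Z + 1) - 1)
    = \prod_(i < k) (q%:R ^+ (n - i) - 1) :> R.
  apply: eq_bigr => i _; congr (_ - 1).
  by have -> : n%:Z - i.+1%:Z + 1 = (n - i)%N%:Z by have := ltn_ord i; lia.
rewrite -qbin_prod mulfK //; apply/prodf_neq0 => i _.
have : (q ^ 0 < q ^ i.+1)%N by rewrite ltn_exp2l.
by rewrite subr_eq0 -natrX pnatr_eq1 => ?; rewrite gtn_eqF.
Qed.

(** Checks family by family that the factor [q ^ e * kappa] of the generator counts is q to the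
    power epsilon. *)
Lemma sqrt_card_exp (F : finFieldType) (T : polar_family) :
  (kind_of T = HermitianForm -> #|F| = (Nat.sqrt #|F| ^ 2)%N) ->
  Num.sqrt (#|F|%:R : R) ^+ two_eps T
  = (#|F| ^ ambient_dim T 0 * kind_kappa F (kind_of T))%:R.
Proof.
move=> sq; have q0 : 0 <= #|F|%:R :> R by exact: ler0n.
have sqr2 := sqr_sqrtr q0.
have herm : kind_of T = HermitianForm ->
    Num.sqrt (#|F|%:R : R) = (Nat.sqrt #|F|)%:R.
  by move=> /sq {1}->; rewrite natrX sqrtr_sqr ger0_norm ?ler0n.
case: T sq herm => /= _ herm.
- by rewrite muln0 expn0 expr0.
- by rewrite muln0 expn0 mul1n expr1 herm.
- by rewrite sqr2 muln0 expn1 muln1.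
- by rewrite sqr2 muln0 expn0 mul1n.
- by rewrite exprS sqr2 herm // natrM mulrC muln0 expn1.
- by rewrite muln0 muln1 natrX -[4%N]/(2 * 2)%N exprM sqr2.
Qed.

(** For [s = 0] the lower argument of the Gaussian coefficient is -1 and its value 0, whereas the
    truncated [s - 1] would give 1; hence the case distinction. *)
Lemma b10E (F : finFieldType) (T : polar_family) (d s : nat) :
  (4 * s <= d)%N ->
  b10 R F T d (2 * s) =
  (if s == 0%N then 0
   else qbin #|F| (d - 3 * s) (s - 1) * EKR_max F T (4 * s - 1) (2 * s))%:R.
Proof.
move=> ds; rewrite /b10 /= mul2n doubleK -mul2n.
have [->|s0] := eqVneq s 0%N.
  by rewrite /gauss /= mul0r.
have -> : d%:Z - 3 * s%:Z = (d - 3 * s)%N%:Z by lia.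
have -> : s%:Z - 1 = (s - 1)%N%:Z by lia.
by rewrite gauss_qbin ?finNzRing_gt1 // natrM mulnA.
Qed.

Lemma b20E (F : finFieldType) (T : polar_family) (d s : nat) :
  (kind_of T = HermitianForm -> #|F| = (Nat.sqrt #|F| ^ 2)%N) ->
  (4 * s <= d)%N ->
  b20 R F T d (2 * s) =
  ((#|F| ^ ambient_dim T 0 * kind_kappa F (kind_of T)) ^ s * #|F| ^ 'C(s, 2) *
   (#|F| ^ (3 * s ^ 2) * \sum_(1 <= i < s)
     #|F| ^ ((s - 1 - i) * (s - i)) * qbin #|F| (d - 4 * s + 1) (s - i)
       * qbin #|F| (s - 1) i))%:R.
Proof.
move=> sq ds; rewrite /b20 /psi0 /= mul2n doubleK -mul2n.
rewrite exprM sqrt_card_exp // -!natrX !natrM natr_sum.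
do 2!congr (_ * _); apply: eq_big_nat => i /andP[i1 si].
have -> : d%:Z - 2 * (2 * s)%N%:Z + 1 = (d - 4 * s + 1)%N%:Z by lia.
have -> : s%:Z - 1 = (s - 1)%N%:Z by lia.
have -> : s%:Z - i%:Z = (s - i)%N%:Z by lia.
by rewrite !gauss_qbin ?finNzRing_gt1 // -natrX !natrM.
Qed.

End Bounds.

Theorem theorem4p7 (R : rcfType) (F : finFieldType) (T : polar_family)
    (d t : nat) (A : 'M[F]_(ambient_dim T d))
    (Y : {set {vspace 'rV[F]_(ambient_dim T d)}}) :
  (2 < d)%N ->
  ~~ odd t ->
  (2 * t <= d)%N ->
  is_polar_space A ->
  is_maximal_EKR A t Y ->
  b10 R F T d t + b20 R F T d t < #|Y|%:R ->
  exists2 G : {vspace 'rV[F]_(ambient_dim T d)},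
    is_generator A G &
    Y = [set y | is_generator A y & (d - t./2 <= \dim (y :&: G))%N].
Proof.
move=> _ t_even; have {t_even} -> : t = (2 * t./2)%N.
  by rewrite mul2n -{1}(odd_double_half t) (negPf t_even).
move: t./2 => s; have -> : (2 * s)./2 = s by rewrite mul2n doubleK.
rewrite mulnA -[(2 * 2)%N]/4%N => ds polA maxY.
have [nd /eqP rk] := andP polA.
have sq : kind_of T = HermitianForm -> #|F| = (Nat.sqrt #|F| ^ 2)%N.
  by move=> K; move: nd; rewrite K => /and3P[/eqP].
rewrite b10E // b20E // -natrD ltr_nat => ltY.
have PA := kind_axioms nd; have [rle _] := (polar_rankP nd d).1 rk.
have genE U := generatorE nd U rk.
have /maxsetP[EKRY Ymax] := maxY.
have [/forallP Ygen /forallP Ypair] := andP EKRY.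
have Y_gen : {in Y, forall y,
    gen (kind_form (kind_of T) A) (kind_sing (kind_of T) A) d y}.
  by move=> y yY; rewrite -genE; exact: (implyP (Ygen y)).
have Y_EKR : {in Y &, forall y1 y2, (d <= \dim (y1 :&: y2) + 2 * s)%N}.
  move=> y z yY zY; have /implyP/(_ yY)/forallP/(_ z)/implyP/(_ zY) := Ypair y.
  by dimlia.
have Yn0 : Y != set0 by rewrite -card_gt0; apply: leq_trans ltY.
have [|G gG YG] := EKR_center PA rle (ambient_dimE T d) ds Y_gen Y_EKR Yn0 _ ltY.
  (* For [s = 0] the bound is 0: no intersection with [S] has dimension above [d]. *)
  move=> S tS dS; have [s0|s0] := eqVneq s 0%N.
    rewrite leqn0 cards_eq0; apply/eqP/setP => y; rewrite !inE s0.
    have := dimvS (capvSr y S); move: dS; rewrite s0; case: (y \in Y) => //=.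
    by dimlia.
  rewrite -lt0n in s0; apply: (near_card ds s0 tS dS) => P tP dP.
  exact: card_EKR_through polA EKRY tP dP.
exists G; first by rewrite /is_generator genE.
have [_ dG] := genP _ _ _ _ gG.
(* By maximality it suffices that the set on the right contains [Y] and is an EKR set: two subspaces
   of [G] of dimension at least [d - s] meet in dimension at least [d - 2s]. *)
symmetry; apply: Ymax; last first.
  apply/subsetP => y yY; rewrite inE /is_generator genE Y_gen //=.
  by move: (YG y yY); dimlia.
apply/andP; split; first by apply/forallP => y; apply/implyP; rewrite inE => /andP[].
apply/forallP => y; apply/implyP; rewrite inE => /andP[_ yG].
apply/forallP => z; apply/implyP; rewrite inE => /andP[_ zG].
have sub : (y :&: G + z :&: G <= G)%VS by rewrite subv_add !capvSr.
have sub' : (y :&: G :&: (z :&: G) <= y :&: z)%VS by rewrite capvS ?capvSl.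
have := dimv_sum_cap (y :&: G) (z :&: G); move: (dimvS sub) (dimvS sub') yG zG.
by rewrite dG; dimlia.
Qed.
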